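(* Let $\mathbb{E}_{\mathrm{bgs}}$ be the set of primes $p$ for which $\Gamma$ does not act transitively on $\mathbb{X}^*(p)$. Then: (a) $\mathbb{E}_{\mathrm{bgs}}$ is finite and explicitly bounded (i.e. it is possible to write down an explicit upper bound on the largest prime in $\mathbb{E}_{\mathrm{bgs}}$). (b) For all primes $p\notin\mathbb{E}_{\mathrm{bgs}}$, $\mathbb{X}$ satisfies strong approximation at $p$, i.e. the reduction map $\mathbb{X}(\mathbb{Z})\to\mathbb{X}(\mathbb{F}_p)$ is surjective.
   Context: $\mathbb{X}\subset\mathbb{A}^3_{\mathbb{Z}}$ is the affine surface $x^2+y^2+z^2-xyz=0$. For a prime $p$, $\mathbb{X}^*(p):=\mathbb{X}(\mathbb{F}_p)\setminus\{(0,0,0)\}$. $\Gamma$ is the group of polynomial automorphisms of $\mathbb{A}^3$ generated by permutations of the coordinates and the Vieta involution $(x,y,z)\mapsto(x,y,xy-z)$; it preserves $\mathbb{X}$ and acts on $\mathbb{X}^*(p)$. For $p=3$ the set $\mathbb{X}^*(3)$ is empty, and the action is regarded as transitive. *)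

(* Defs.v *)
From mathcomp Require Import all_boot all_order all_algebra all_fingroup.
From mathcomp Require Import mpoly.
From mathcomp Require Import classical_sets functions cardinality.

Set Implicit Arguments.
Unset Strict Implicit.
Unset Printing Implicit Defensive.

Import GRing.Theory.

Local Open Scope ring_scope.
Local Open Scope classical_set_scope.

Definition axis (i : nat) : {mpoly int[3]} := 'X_(inord i : 'I_3).

Local Notation x_ := (axis 0).
Local Notation y_ := (axis 1).
Local Notation z_ := (axis 2).

(* The value at an R-point of A^3 of a polynomial with integer coefficients,
   along the unique ring morphism from Z to R. *)
Definition eval_at (R : comNzRingType) (P : 3.-tuple R) (f : {mpoly int[3]}) : R :=
  mmap (intr : int -> R) (tnth P) f.

Definition markoff_poly : {mpoly int[3]} :=
  x_ ^+ 2 + y_ ^+ 2 + z_ ^+ 2 - x_ * y_ * z_.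

Definition markoff (R : comNzRingType) : set (3.-tuple R) :=
  [set P | eval_at P markoff_poly = 0].

Definition origin (R : comNzRingType) : 3.-tuple R := [tuple 0 | _ < 3].

Definition markoff_star (p : nat) : set (3.-tuple 'F_p) :=
  @markoff 'F_p `\ origin 'F_p.

(* A polynomial endomorphism (x, y, z) |-> (f0, f1, f2) of A^3 over Z is
   represented by the triple (f0, f1, f2). *)
Definition polymap := 3.-tuple {mpoly int[3]}.

Definition polymap_id : polymap := [tuple 'X_i | i < 3].

(* g \mPo f substitutes the components of f for the variables of g, so this
   is "first f, then g" on points. *)
Definition polymap_comp (g f : polymap) : polymap :=
  [tuple tnth g i \mPo f | i < 3].

Definition polymap_act (R : comNzRingType) (g : polymap) (P : 3.-tuple R) :
  3.-tuple R := [tuple eval_at P (tnth g i) | i < 3].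

Definition perm_map (s : 'S_3) : polymap := [tuple 'X_(s i) | i < 3].

Definition vieta : polymap := [tuple x_; y_; x_ * y_ - z_].

Inductive Gamma : polymap -> Prop :=
| Gamma_perm (s : 'S_3) : Gamma (perm_map s)
| Gamma_vieta : Gamma vieta
| Gamma_id : Gamma polymap_id
| Gamma_comp (g f : polymap) : Gamma g -> Gamma f -> Gamma (polymap_comp g f)
| Gamma_inv (g f : polymap) :
    polymap_comp g f = polymap_id -> polymap_comp f g = polymap_id ->
    Gamma g -> Gamma f.

(* The empty set counts as transitive. *)
Definition Gamma_transitive (p : nat) : Prop :=
  forall P Q : 3.-tuple 'F_p, markoff_star P -> markoff_star Q ->
  exists2 g : polymap, Gamma g & polymap_act g P = Q.

Definition E_bgs : set nat := [set p | prime p /\ ~ Gamma_transitive p].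

Definition reduction (p : nat) (P : 3.-tuple int) : 3.-tuple 'F_p :=
  [tuple (tnth P i)%:~R | i < 3].

Definition strong_approximation_at (p : nat) : Prop :=
  set_surj (@markoff int) (@markoff 'F_p) (@reduction p).

(* An explicit upper bound has to be written down as a closed numeral; this one
   is deliberately far from optimal (3.448 * 10^392 is known to suffice), and
   is not meant to be evaluated. *)
Definition bgs_bound : nat := (10 ^ (10 ^ 100))%N.

(* Main.v *)
Require Import Defs.
From mathcomp Require Import mpoly.
From mathcomp Require Import classical_sets functions cardinality.
From mathcomp Require Import all_boot all_order all_algebra all_fingroup all_solvable all_field.
From mathcomp Require Import zify ring.
From Stdlib Require Import Classical.

(* Let O be an orbit on X^*(p), closed under rotation : (x,y,z) |-> (x,z,xz-y), let
   X be its set of coordinates, and let k be (twice) the number of divisors of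
   p-1 and p+1, which is p^o(1).

   p divides |O|: the equation says x/(yz) + y/(xz) + z/(xy) = 1, and z/(xy)
   telescopes to x/(yz) under the rotation (this is Martin's short proof of
   Chen's theorem).  As |O| <= 2|X|^2, this gives |X| >= sqrt(p/2).

   Writing x = w + 1/w, a rotation acts on the conic of x with the order of w.
   The most frequent order h is at least |X|/k, and the conics of the elements of
   order h glue to a subset U of the plane F_p^2, |U| >= |X|h/(2k), which is
   stable under a torus of order h: the h/2 directions of a linear form under the
   torus all project U into X.  Counting incidences of U with the lines of these
   directions shows that |X| >= p/2, and then that X misses only O(k^3) elements
   of F_p, unless h is at most about sqrt(kp).

   In that last case |X| and h are p^(1/2+o(1)).  Relations between three
   directions force the additive energy of X and rX to be nearly maximal for every
   ratio r of two "sines" (w^n - 1/w^n)/(w - 1/w), so that the set S of sines has a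
   small ratio set.  By Pluennecke SS is small, hence so is T - T, where T is the
   set of "cosines" w^2n + 1/w^2n; but TT is contained in T + T, which contradicts
   the sum-product phenomenon in F_p.

   Finally, if two orbits both miss only O(k^3) coordinates, they share one of the
   form g + 1/g with g a primitive root; the rotation is transitive on its conic,
   so the orbits coincide.

   Strong approximation follows by lifting a word of Gamma from the reduction of
   the integral point (3,3,3), p = 3 being treated by inspection. *)

Set Implicit Arguments.
Unset Strict Implicit.
Unset Printing Implicit Defensive.

Import Order.TTheory GRing.Theory Num.Theory.

(** * The Pluennecke inequality *)

Section Pluennecke.

Variable gT : finGroupType.
Hypothesis gC : abelian [set: gT].
Implicit Types A B C X Z : {set gT}.
Local Open Scope group_scope.

Lemma abelian_mulsC A B : A * B = B * A.
Proof.
apply/setP=> x; apply/mulsgP/mulsgP=> -[a b aA bB ->]; exists b a => //;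
  by apply: (centsP gC); rewrite inE.
Qed.

(* Petridis: X minimizes |X B| / |X| among its nonempty subsets. *)
Lemma petridis X B :
  (forall Z, Z \subset X -> Z != set0 -> #|X * B| * #|Z| <= #|Z * B| * #|X|) ->
  forall C, #|X * B * C| * #|X| <= #|X * B| * #|X * C|.
Proof.
move=> minX C; have [n] := ubnP #|C|; elim: n C => // n IH C ltC.
have [->|[c cC]] := set_0Vmem C.
  by rewrite !mulg0 /= ?cards0.
pose C' := C :\ c.
have defC : C = C' :|: [set c] by rewrite setUC setD1K.
have IH' : #|X * B * C'| * #|X| <= #|X * B| * #|X * C'|.
  apply: IH; move: ltC; rewrite (cardsD1 c C) cC; exact.
(* For x in [Z] the product x c already lies in X C', so X C gains exactly |X| - |Z| elements over X
   C'. As Z B c lies in X B C', the set X B C gains at most |X B| - |Z B|, and minimality compares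
   the two gains. *)
pose Z := [set x in X | x * c \in X * C'].
have sZX : Z \subset X by apply/subsetP=> x; rewrite inE => /andP[].
have minZ : #|X * B| * #|Z| <= #|Z * B| * #|X|.
  have [->|Z0] := eqVneq Z set0; first by rewrite cards0 muln0.
  exact: minX.
have cardXC : #|X * C| = #|X * C'| + (#|X| - #|Z|).
  rewrite -(cardsDS sZX) -(card_rcoset (X :\: Z) c) -cardsUI.
  rewrite [X in _ = _ + X](_ : _ = 0); last first.
    apply/eqP; rewrite cards_eq0; apply/eqP/setP=> y; rewrite !inE.
    apply/negP=> /andP[yC' /rcosetP[x]]; rewrite !inE => /andP[+ xX] ey.
    by rewrite xX -ey yC'.
  rewrite addn0; congr #|pred_of_set _|; rewrite {1}defC mulgU.
  apply/setP=> y; rewrite !inE; apply/orP/orP=> -[yC'|]; try by left.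
    move=> /rcosetP[x xX ->]; have [xZ|xZ] := boolP (x \in Z).
      by left; move: xZ; rewrite inE => /andP[].
    by right; apply/rcosetP; exists x; rewrite // inE xZ.
  by case/rcosetP=> x; rewrite inE => /andP[_ xX] ->; right; apply/rcosetP; exists x.
have sZB : Z * B \subset X * B by apply: mulSg.
have cardXBC : #|X * B * C| <= #|X * B * C'| + (#|X * B| - #|Z * B|).
  rewrite -(cardsDS sZB) -(card_rcoset (X * B :\: Z * B) c).
  apply: leq_trans (leq_card_setU _ _); apply/subset_leq_card/subsetP=> y.
  rewrite {1}defC mulgU !inE => /orP[->//|/rcosetP[x xXB ->]].
  have [xZ|xZ] := boolP (x \in Z * B); last first.
    by apply/orP; right; apply/rcosetP; exists x; rewrite // inE xZ.
  apply/orP; left; case/mulsgP: xZ => z b; rewrite inE => /andP[_ zc] bB ->.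
  have -> : z * b * c = z * c * b.
    by rewrite -!mulgA; congr (_ * _); apply: (centsP gC); rewrite inE.
  rewrite -[X * B * C']mulgA (abelian_mulsC B C') [X * (_ * _)]mulgA.
  exact: mem_mulg.
have leZX := subset_leq_card sZX.
have leZB := subset_leq_card sZB.
rewrite cardXC mulnDr mulnBr.
apply: leq_trans (leq_mul cardXBC (leqnn _)) _.
rewrite mulnDl mulnBl; lia.
Qed.

(** X minimizes |X B| / |X| over the nonempty subsets of A; comparing it with A itself gives the
    third clause. *)
Lemma petridis_exists A B : A != set0 ->
  exists X, [/\ X \subset A, X != set0,
    #|X * B| * #|A| <= #|A * B| * #|X| &
    forall C, #|X * B * C| * #|X| <= #|X * B| * #|X * C|].
Proof.
move=> A0.
pose P (X : {set gT}) := (X \subset A) && (X != set0).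
have PA : P A by rewrite /P subxx.
pose good X := P X && [forall Z, P Z ==> (#|X * B| * #|Z| <= #|Z * B| * #|X|)].
have [X gX] : exists X, good X.
  pose f (X : {set gT}) : rat := (#|(X * B)%g|%:R / #|X|%:R)%R.
  case: (@arg_minP _ _ _ A P f PA) => X PX minX.
  exists X; rewrite /good PX; apply/forall_inP=> Z PZ.
  have := minX Z PZ; rewrite /f.
  have X0 : (0 < #|X|%:R :> rat)%R by rewrite ltr0n card_gt0; case/andP: PX.
  have Z0 : (0 < #|Z|%:R :> rat)%R by rewrite ltr0n card_gt0; case/andP: PZ.
  by rewrite ler_pdivrMr // mulrAC ler_pdivlMr // -!natrM ler_nat.
case/andP: gX => /andP[sXA X0] /forall_inP minX.
exists X; split=> //; first by apply: minX; rewrite /P subxx.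
apply: petridis => Z sZX Z0; apply: minX; rewrite /P Z0 andbT.
exact: subset_trans sXA.
Qed.

Lemma petridis_iter X B :
  (forall C, #|X * B * C| * #|X| <= #|X * B| * #|X * C|) ->
  forall n, #|X * B ^+ n| * expn #|X| n <= expn #|X * B| n * #|X|.
Proof.
move=> pX; elim=> [|n IH]; first by rewrite expg0 mulg1 expn0 mul1n muln1.
rewrite expgS mulgA [X in _ * X <= _]expnS mulnA.
apply: leq_trans (leq_mul (pX _) (leqnn _)) _.
by rewrite -mulnA expnS -mulnA leq_mul2l IH orbT.
Qed.

(** Fix a representation d = a / b of each quotient d. The map from (x, d) to (x a, x b) is
    injective: d is the quotient of the two components, and then x cancels. *)
Lemma ruzsa_triangle X A B : #|X| * #|A * B^-1| <= #|X * A| * #|X * B|.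
Proof.
have [f fP] : exists f : gT -> gT * gT,
    forall d, d \in A * B^-1 -> [/\ (f d).1 \in A, (f d).2 \in B & d = (f d).1 * ((f d).2)^-1].
  exists (fun d => odflt (1, 1) [pick u | [&& u.1 \in A, u.2 \in B & d == u.1 * (u.2)^-1]]).
  move=> d; case: pickP => [u /and3P[uA uB /eqP] | no] //.
  case/mulsgP=> a b aA; rewrite inE => bB ed.
  by have /negP[] := no (a, b^-1); rewrite /= aA bB invgK ed eqxx.
rewrite -!cardsX.
pose g (u : gT * gT) := (u.1 * (f u.2).1, u.1 * (f u.2).2).
rewrite -(card_in_imset (f := g)); last first.
  move=> [x d] [x' d']; rewrite !inE /g /= => /andP[_ dD] /andP[_ dD'] [e1 e2].
  have [_ _ ed] := fP _ dD; have [_ _ ed'] := fP _ dD'.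
  have edd : d = d'.
    rewrite ed ed'.
    have -> : (f d).1 * (f d).2^-1 = (x * (f d).1) * (x * (f d).2)^-1.
      rewrite invMg mulgA -(mulgA x) (_ : x * _ = (f d).1 * (f d).2^-1 * x) ?mulgK //.
      by apply: (centsP gC); rewrite inE.
    rewrite e1 e2 invMg mulgA -(mulgA x').
    rewrite (_ : x' * _ = (f d').1 * (f d').2^-1 * x') ?mulgK //.
    by apply: (centsP gC); rewrite inE.
  by rewrite -edd in e1 *; rewrite (mulIg _ _ _ e1).
apply/subset_leq_card/subsetP=> w /imsetP[[x d]]; rewrite !inE /= => /andP[xX dD] ->.
by have [fA fB _] := fP _ dD; rewrite /g /= !mem_mulg.
Qed.

(** The Ruzsa triangle through the Petridis subset X of A reduces the claim to |X B^m| and |X B^n|,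
    which grow by |X B| / |X| <= |A B| / |A| per factor; finally |X| <= |A|. *)
Lemma pluennecke A B m n : A != set0 -> B != set0 ->
  #|B ^+ m * (B ^+ n)^-1| * expn #|A| (m + n)%N <= expn #|A * B| (m + n)%N * #|A|.
Proof.
move=> A0 B0.
have [X [sXA X0 XB pX]] := petridis_exists B A0.
have Xgt0 : 0 < #|X| by rewrite card_gt0.
have Agt0 : 0 < #|A| by rewrite card_gt0.
have leXA : #|X| <= #|A| := subset_leq_card sXA.
have XBk k : expn #|X * B| k * expn #|A| k <= expn #|A * B| k * expn #|X| k.
  by rewrite -!expnMn; elim: k => // k IHk; rewrite !expnS; apply: leq_mul.
have tri := ruzsa_triangle X (B ^+ m) (B ^+ n).
have im := petridis_iter pX m; have iq := petridis_iter pX n.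
have h1 := leq_mul im iq.
have h2 := XBk (m + n)%N.
set D := #|B ^+ m * _| in tri *.
have h3 : D * expn #|X| (m + n)%N <= expn #|X * B| (m + n)%N * #|X|.
  rewrite -(leq_pmul2l Xgt0).
  apply: leq_trans (_ : (#|X * B ^+ m| * #|X * B ^+ n|) * expn #|X| (m + n)%N <= _).
    by rewrite mulnA leq_mul2r tri orbT.
  move: h1; rewrite !expnD; nia.
have Xk : 0 < expn #|X| (m + n)%N by rewrite expn_gt0 Xgt0.
rewrite -(leq_pmul2r Xk).
apply: leq_trans (_ : expn #|X * B| (m + n)%N * #|X| * expn #|A| (m + n)%N <= _).
  by rewrite mulnAC leq_mul2r h3 orbT.
apply: leq_trans (_ : expn #|A * B| (m + n)%N * expn #|X| (m + n)%N * #|X| <= _).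
  by rewrite mulnAC leq_mul2r h2 orbT.
by rewrite -!mulnA leq_mul2l mulnC leq_mul2r leXA !orbT.
Qed.

End Pluennecke.

(** * Additive energy and sum-product *)

(** Cauchy-Schwarz, from 2ab <= a^2 + b^2 summed over all pairs. *)
Lemma sqr_sum_leq (I : finType) (B : {pred I}) (f : I -> nat) :
  (\sum_(i in B) f i) ^ 2 <= #|B| * \sum_(i in B) f i ^ 2.
Proof.
rewrite -(leq_pmul2l (isT : 0 < 2)).
rewrite -[X in 2 * X]mulnn big_distrlr /= big_distrr /=.
apply: leq_trans (_ : \sum_(i in B) \sum_(j in B) (f i ^ 2 + f j ^ 2) <= _).
  apply: leq_sum => i _; rewrite big_distrr /=; apply: leq_sum => j _.
  exact: nat_Cauchy.
under eq_bigr do rewrite big_split /= sum_nat_const.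
by rewrite big_split /= sum_nat_const -big_distrr /= mul2n addnn.
Qed.

Definition collisions (aT rT : finType) (A : {set aT}) (f : aT -> rT) : {set aT * aT} :=
  [set u | [&& u.1 \in A, u.2 \in A & f u.1 == f u.2]].

Lemma card_collisions (aT rT : finType) (A : {set aT}) (f : aT -> rT) :
  #|collisions A f| = \sum_b #|[set x in A | f x == b]| ^ 2.
Proof.
rewrite -sum1_card (partition_big (fun u => f u.1) predT) //=.
apply: eq_bigr => b _; rewrite sum1_card expnS expn1 -cardsX.
apply: eq_card => -[x y]; rewrite !inE /= unfold_in /= inE /=.
by case: (x \in A); case: (y \in A); rewrite ?andbF //= andbC; case: eqP => // ->; rewrite eq_sym.
Qed.

Lemma card_fibers (aT rT : finType) (A : {set aT}) (f : aT -> rT) (B : {set rT}) :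
  #|[set x in A | f x \in B]| = \sum_(b in B) #|[set x in A | f x == b]|.
Proof.
rewrite -sum1_card (partition_big f (mem B)) /=; last by move=> x; rewrite inE => /andP[].
apply: eq_bigr => b bB; rewrite sum1_card; apply: eq_card => x.
by rewrite unfold_in /= !inE; case: eqP => [->|]; rewrite ?bB ?andbT ?andbF.
Qed.

Lemma sqr_card_leq_collisions (aT rT : finType) (A : {set aT}) (f : aT -> rT) (B : {set rT}) :
  #|[set x in A | f x \in B]| ^ 2 <= #|B| * #|collisions A f|.
Proof.
rewrite card_fibers.
apply: leq_trans (sqr_sum_leq _ _) _; rewrite leq_mul2l card_collisions; apply/orP; right.
by rewrite [X in _ <= X](bigID (mem B)) /= leq_addr.
Qed.

Section Field.
Variable F : finFieldType.
Local Open Scope ring_scope.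

(** The additive energy of X and rX. *)
Definition energy (X : {set F}) (r : F) : nat :=
  #|collisions (setX X X) (fun u => u.1 + r * u.2)|.

(** Exchange the sums: a quadruple with (a, b) != (c, d) satisfies a + r b = c + r d for at most one
    r, namely (c - a) / (b - d), while a diagonal one does so for every r. *)
Lemma sum_energy (X : {set F}) :
  (\sum_r energy X r <= #|X| ^ 4 + #|F| * #|X| ^ 2)%N.
Proof.
pose D : {set (F * F) * (F * F)} := setX (setX X X) (setX X X).
have cardD : #|D| = (#|X| ^ 4)%N by rewrite !cardsX; lia.
have -> : (\sum_r energy X r = \sum_(u in D) #|[set r : F | (u.1.1 + r * u.1.2 == u.2.1 + r * u.2.2)%R]|)%N.
  under eq_bigr => r _ do rewrite /energy -sum1_card.
  under [RHS]eq_bigr => u _ do rewrite -sum1_card.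
  rewrite (exchange_big_dep (mem D)) /=; last first.
    by move=> r [[a b] [c d]] _; rewrite !inE /= => /and3P[-> ->].
  apply: eq_bigr => -[[a b] [c d]]; rewrite !inE /= => /andP[h1 h2].
  by apply: eq_bigl => r; rewrite !inE /= h1 h2.
apply: leq_trans (_ : (\sum_(u in D) (1 + (u.1 == u.2) * #|F|) <= _)%N).
  apply: leq_sum => -[[a b] [c d]] _ /=.
  have [[<- <-]|ne] := eqVneq (a, b) (c, d); first by rewrite mul1n (leq_trans (max_card _)) ?leq_addl.
  rewrite mul0n addn0 -(cards1 ((c - a) / (b - d))).
  apply/subset_leq_card/subsetP=> r; rewrite !inE => /eqP e.
  have bd : b - d != 0.
    apply: contraNneq ne => /eqP; rewrite subr_eq0 => /eqP bd; move: e.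
    by rewrite bd => /addIr ->.
  by apply/eqP/(mulIf bd); rewrite mulfVK // mulrBr; move/eqP: e; rewrite -subr_eq0 => /eqP e;
     apply/eqP; rewrite -subr_eq0 -e; apply/eqP; ring.
rewrite big_split /= sum1_card cardD leq_add2l -big_distrl /= mulnC leq_mul2l.
apply/orP; right; rewrite -big_mkcondr /= sum1_card.
have -> : (#|X| ^ 2)%N = #|setX X X| by rewrite cardsX; lia.
rewrite -(card_imset (setX X X) (f := fun u => (u, u))); last by move=> u v [].
apply/subset_leq_card/subsetP=> -[u v]; rewrite unfold_in /= !inE /= => /andP[/andP[uX _] /eqP <-].
by apply/imsetP; exists u; rewrite ?inE.
Qed.

Lemma sumset_energy (X : {set F}) (r : F) :
  (#|X| ^ 4 <= #|[set (a + r * b)%R | a in X, b in X]| * energy X r)%N.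
Proof.
have := sqr_card_leq_collisions (setX X X) (fun u => u.1 + r * u.2) [set (a + r * b)%R | a in X, b in X].
rewrite (_ : [set x in setX X X | _] = setX X X); first by rewrite cardsX -mulnn /energy; lia.
apply/setP=> -[a b]; rewrite inE; apply: andb_idr; rewrite inE => /andP[/= aX bX].
by apply/imset2P; exists a b.
Qed.

(** An r of minimal energy has at most the average energy given by [sum_energy], and small energy
    forces a large sumset. *)
Lemma exists_large_sumset (X : {set F}) :
  exists r : F, (#|F| * #|X| ^ 2 <= #|[set (a + r * b)%R | a in X, b in X]| * (#|X| ^ 2 + #|F|))%N.
Proof.
have [r _ minr] := arg_minnP (energy X) (isT : xpredT (0 : F)).
exists r; have lesum := sum_energy X.
have : (#|F| * energy X r <= #|X| ^ 4 + #|F| * #|X| ^ 2)%N.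
  apply: leq_trans lesum; rewrite -sum_nat_const; apply: leq_sum => s _; exact: minr.
have := sumset_energy X r; set R := #|[set _ | _ in _, _ in _]|; move=> h1 h2.
have [X0|X0] := posnP #|X|; first by rewrite X0; lia.
rewrite -(leq_pmul2r (_ : 0 < #|X| ^ 2)%N) ?expn_gt0 ?X0 //.
have h3 : (R * (#|F| * energy X r) <= R * (#|X| ^ 4 + #|F| * #|X| ^ 2))%N by rewrite leq_mul2l h2 orbT.
have h4 : (#|F| * #|X| ^ 4 <= #|F| * (R * energy X r))%N by rewrite leq_mul2l h1 orbT.
move: h3 h4; rewrite (expnD _ 2 2) => h3 h4; nia.
Qed.

End Field.

(** * Sum-product in F_p by pivoting *)

Section Pivot.
Variables (p : nat) (p_pr : prime p) (T : {set 'F_p}).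
Local Open Scope ring_scope.
Hypothesis T_gt1 : (1 < #|T|)%N.
Hypothesis T_mul : forall a b, a \in T -> b \in T ->
  exists c d, [/\ c \in T, d \in T & a * b = c + d].

Local Notation D66 := (T ^+ 6 * (T ^+ 6)^-1)%g.

Lemma mem_diff66 (a b : nat -> 'F_p) :
  (forall i, a i \in T) -> (forall i, b i \in T) ->
  \sum_(i < 6) a i - \sum_(i < 6) b i \in D66.
Proof.
have H (c : nat -> 'F_p) n : (forall i, c i \in T) -> \sum_(i < n) c i \in (T ^+ n)%g.
  move=> cT; elim: n => [|n IH]; first by rewrite big_ord0 expg0 inE.
  by rewrite big_ord_recr expgSr; apply: (mem_mulg IH).
move=> aT bT; set s := \sum_(i < 6) a i; set t := \sum_(i < 6) b i.
have : (s * t^-1)%g \in D66 by rewrite mem_mulg ?memV_invg /s /t ?H.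
by [].
Qed.

(** The set (T - T) / (T - T). *)
Definition quotient_set : {set 'F_p} :=
  [set r | [exists u : ('F_p * 'F_p) * ('F_p * 'F_p),
    [&& u.1.1 \in T, u.1.2 \in T, u.2.1 \in T, u.2.2 \in T, u.2.1 != u.2.2 &
        r == (u.1.1 - u.1.2) / (u.2.1 - u.2.2)]]].

(** Multiplying x + (r + e) y by the denominator of r leaves a signed sum of products of two
    elements of T, and [T_mul] splits each product into two summands: six with a plus and six with a
    minus. *)
Lemma pivot_small r (e : bool) : r \in quotient_set ->
  (#|[set (a + (r + e%:R) * b)%R | a in T, b in T]| <= #|D66|)%N.
Proof.
rewrite inE => /existsP[[[a b] [c d]] /= /and5P[aT bT cT dT /andP[cd /eqP ->]]].
have cd0 : c - d != 0 by rewrite subr_eq0.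
rewrite -(card_imset _ (mulfI cd0)); apply/subset_leq_card/subsetP=> w /imsetP[v /imset2P[x y xT yT ->] ->].
have [x1 [x2 [x1T x2T ecx]]] := T_mul cT xT.
have [x3 [x4 [x3T x4T edx]]] := T_mul dT xT.
have [x5 [x6 [x5T x6T eay]]] := T_mul aT yT.
have [x7 [x8 [x7T x8T eby]]] := T_mul bT yT.
have [y1 [y2 [y3 [y4 [y1T [y2T [y3T [y4T ey]]]]]]]] : exists y1 y2 y3 y4,
    y1 \in T /\ y2 \in T /\ y3 \in T /\ y4 \in T /\ e%:R * (c * y - d * y) = y1 + y2 - (y3 + y4).
  case: e => /=; last by exists x, x, x, x; do !split=> //; rewrite mul0r subrr.
  have [z1 [z2 [z1T z2T ecy]]] := T_mul cT yT.
  have [z3 [z4 [z3T z4T edy]]] := T_mul dT yT.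
  by exists z1, z2, z3, z4; do !split=> //; rewrite mul1r ecy edy.
have -> : (c - d) * (x + ((a - b) / (c - d) + e%:R) * y) =
    \sum_(i < 6) nth x [:: x1; x2; x5; x6; y1; y2] i -
    \sum_(i < 6) nth x [:: x3; x4; x7; x8; y3; y4] i.
  rewrite !big_ord_recl !big_ord0 /= !addr0.
  transitivity (c * x - d * x + (a * y - b * y) + e%:R * (c * y - d * y)); first by field.
  by rewrite ecx edx eay eby ey; ring.
by apply: mem_diff66 => -[|[|[|[|[|[|i]]]]]] //=; rewrite nth_nil.
Qed.

(** If the quotient set is all of F_p, it contains an r with a large sumset T + rT. Otherwise adding
    1 leaves it at some r, and T + (r + 1)T has |T|^2 elements, since a collision would write r + 1
    as a quotient of differences. [pivot_small] bounds either sumset. *)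
Lemma pivot : (p * #|T| ^ 2 <= #|D66| * (#|T| ^ 2 + p))%N.
Proof.
have cardF : #|'F_p| = p := card_Fp p_pr.
have [c [d [cT dT cd]]] : exists c d, [/\ c \in T, d \in T & c != d].
  by have /card_gt1P[c [d [cT dT cd]]] := T_gt1; exists c, d.
have Q0 : 0 \in quotient_set.
  rewrite inE; apply/existsP; exists ((c, c), (c, d)).
  by rewrite /= cT dT cd subrr mul0r eqxx.
have [/forallP Qfull|] := boolP [forall r, r \in quotient_set].
  have [r] := exists_large_sumset T; rewrite cardF => hr.
  apply: leq_trans hr _; rewrite leq_mul2r; apply/orP; right.
  by have := @pivot_small r false (Qfull r); rewrite addr0.
move=> notfull.
(* Only here is it essential that F_p has no proper subfield. *)
have [r Qr Qr1] : exists2 r, r \in quotient_set & r + 1 \notin quotient_set.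
  apply/exists_inP; apply: contraR notfull => /exists_inPn hQ.
  apply/forallP=> x; rewrite -[x]natr_Zp; elim: (x : nat) => // n IH.
  by rewrite -natr1; have := hQ _ IH; rewrite negbK.
have := @pivot_small r true Qr.
rewrite curry_imset2X card_in_imset; last first.
  move=> [a b] [a' b']; rewrite !inE /= => /andP[aT bT] /andP[a'T b'T] e.
  have [ebb|nbb] := eqVneq b b'; first by move: e; rewrite ebb => /addIr ->.
  case/negP: Qr1; rewrite inE; apply/existsP; exists ((a', a), (b, b')) => /=.
  rewrite a'T aT bT b'T nbb /=.
  have bb0 : b - b' != 0 by rewrite subr_eq0.
  by apply/eqP/(mulIf bb0); rewrite mulfVK //; move/eqP: e; rewrite -subr_eq0 => /eqP e;
     apply/eqP; rewrite -subr_eq0 -e; apply/eqP; rewrite mulr1n; ring.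
rewrite cardsX mulnn => h; rewrite mulnC; apply: leq_mul => //; exact: leq_addl.
Qed.

End Pivot.

(** * The divisor bound *)

(* The number of divisors of n; only one inequality between this formula and
   [size (divisors n)] is needed, while [leq_ndiv_totient] uses the formula. *)
Definition ndiv n := \prod_(q <- primes n) (logn q n).+1.

Lemma prod_primes_logn n : 0 < n -> n = \prod_(q <- primes n) q ^ logn q n.
Proof.
by move=> n0; rewrite {1}(prod_prime_decomp n0) prime_decompE big_map.
Qed.

(** A divisor d is recovered from gcd(d, a) and d / gcd(d, a); the latter divides b because it is
    coprime to a / gcd(d, a). *)
Lemma size_divisorsM a b : 0 < a -> 0 < b ->
  size (divisors (a * b)) <= size (divisors a) * size (divisors b).
Proof.
move=> a0 b0; have ab0 : 0 < a * b by rewrite muln_gt0 a0.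
rewrite -(size_allpairs (fun x y => (x, y))).
rewrite -(size_map (fun d => (gcdn d a, d %/ gcdn d a))); apply: uniq_leq_size.
  rewrite map_inj_in_uniq ?divisors_uniq // => x y _ _ [e1 e2].
  by rewrite -(divnK (dvdn_gcdl x a)) e2 e1 divnK // dvdn_gcdl.
move=> u /mapP[d]; rewrite -dvdn_divisors // => dab ->.
apply/allpairsP; exists (gcdn d a, d %/ gcdn d a); split=> //=.
  by rewrite -dvdn_divisors // dvdn_gcdr.
rewrite -dvdn_divisors //.
have g0 : 0 < gcdn d a by rewrite gcdn_gt0 a0 orbT.
have cop : coprime (d %/ gcdn d a) (a %/ gcdn d a).
  by rewrite /coprime -(eqn_pmul2r g0) muln_gcdl !divnK ?dvdn_gcdl ?dvdn_gcdr // mul1n.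
rewrite -(Gauss_dvdr _ cop) -(dvdn_pmul2r g0) divnK ?dvdn_gcdl //.
by rewrite mulnAC divnK ?dvdn_gcdr.
Qed.

Lemma size_divisors_leq n : 0 < n -> size (divisors n) <= ndiv n.
Proof.
move=> n0; rewrite {1}(prod_primes_logn n0) /ndiv.
have: all prime (primes n) by apply/allP=> q; rewrite mem_primes => /andP[].
elim: (primes n) => [|q s IH] /=; first by rewrite !big_nil.
case/andP=> qpr spr; rewrite !big_cons.
have s0 : 0 < \prod_(r <- s) r ^ logn r n.
  rewrite big_seq_cond; apply: prodn_cond_gt0 => r /andP[rs _].
  by rewrite expn_gt0 prime_gt0 //; apply: (allP spr).
have q0 : 0 < q ^ logn q n by rewrite expn_gt0 prime_gt0.
apply: leq_trans (size_divisorsM q0 s0) _; apply: leq_mul; last exact: IH.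
rewrite -[X in _ <= X](size_iota 0) -(size_map (fun i => q ^ i) (iota _ _)).
apply: uniq_leq_size (divisors_uniq _) _ => d; rewrite -dvdn_divisors //.
by case/(dvdn_pfactor _ _ qpr) => i le_i ->; apply: map_f; rewrite mem_iota.
Qed.

(** Prime by prime, q^e <= (e + 1) (q - 1) q^(e - 1) for e >= 1, because q <= 2 (q - 1). *)
Lemma leq_ndiv_totient n : 0 < n -> n <= ndiv n * totient n.
Proof.
move=> n0; rewrite totientE // /ndiv -big_split /= {1}(prod_primes_logn n0).
rewrite big_seq [X in _ <= X]big_seq; apply: leq_prod => q; rewrite mem_primes => /and3P[qpr _ qn].
have : 0 < logn q n by rewrite logn_gt0 mem_primes qpr n0.
have := prime_gt1 qpr.
case: (logn q n) => // e; case: q {qpr qn} => // q; rewrite ltnS => q0 _ /=.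
by rewrite expnS mulnA leq_mul2r; apply/orP; right; nia.
Qed.

Lemma exp_succ_leq k e : 0 < k -> e.+1 ^ k <= k ^ k * 2 ^ e.
Proof.
move=> k0.
have h : e.+1 <= k * 2 ^ (e %/ k).
  apply: leq_trans (_ : k * (e %/ k).+1 <= _); first by rewrite mulnC; apply: ltn_ceil.
  by rewrite leq_mul2l ltn_expl ?orbT.
apply: leq_trans (_ : (k * 2 ^ (e %/ k)) ^ k <= _); first by rewrite leq_exp2r.
by rewrite expnMn leq_mul2l -expnM leq_exp2l // leq_divM ?orbT.
Qed.

(** A prime q >= 2^k costs nothing, as (e + 1)^k <= 2^(k e) <= q^e; each of the at most 2^k smaller
    primes costs a factor k^k. *)
Lemma ndiv_exp_leq k n : 0 < k -> 0 < n -> ndiv n ^ k <= (k ^ k) ^ (2 ^ k) * n.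
Proof.
move=> k0 n0; have C0 : 0 < k ^ k by rewrite expn_gt0 k0.
apply: leq_trans (_ : \prod_(q <- primes n) ((if q < 2 ^ k then k ^ k else 1) * q ^ logn q n) <= _).
  rewrite /ndiv (big_morph (fun m => m ^ k) (fun a b => expnMn a b k) (exp1n k)).
  rewrite big_seq [X in _ <= X]big_seq; apply: leq_prod => q; rewrite mem_primes => /and3P[qpr _ qn].
  case: ltnP => hq.
    apply: leq_trans (exp_succ_leq _ k0) _.
    by rewrite leq_mul2l; apply/orP; right; case: (logn q n) => // e; rewrite leq_exp2r // prime_gt1.
  rewrite mul1n; apply: leq_trans (_ : (2 ^ k) ^ logn q n <= _).
    by rewrite -expnM mulnC expnM leq_exp2r // ltn_expl.
  by case: (logn q n) => // e; rewrite leq_exp2r.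
rewrite big_split /= -prod_primes_logn // leq_mul2r; apply/orP; right.
rewrite -big_mkcond -big_filter big_const_seq count_predT iter_muln muln1.
rewrite leq_pexp2l // -[X in _ <= X](size_iota 0); apply: uniq_leq_size.
  by rewrite filter_uniq // primes_uniq.
by move=> q; rewrite mem_filter mem_iota => /andP[].
Qed.

(** * Lines in a finite plane *)

(* W is the plane F^2 and the fibres of lam i form the i-th parallel class of
   lines; only the orthogonality of two distinct classes matters. *)
Section OrthogonalFamily.
Variables (W F I : finType) (lam : I -> W -> F).
Hypothesis cardW : #|W| = #|F| ^ 2.
Hypothesis I_gt1 : 1 < #|I|.
Hypothesis lam_inj : forall i j, i != j -> injective (fun w => (lam i w, lam j w)).
Variable B : {set F}.

Let hits w := #|[set i | lam i w \in B]|.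

Lemma card_orthogonal_pair i j (C : {set F}) : i != j ->
  #|[set w | (lam i w \in B) && (lam j w \in C)]| = #|B| * #|C|.
Proof.
move=> ij; have inj := lam_inj ij.
have bij : bijective (fun w => (lam i w, lam j w)).
  by apply: inj_card_bij => //; rewrite card_prod cardW mulnn.
rewrite -cardsX -(on_card_preimset (f := fun w => (lam i w, lam j w))); last exact: onW_bij.
by apply: eq_card => w; rewrite !inE.
Qed.

Lemma card_orthogonal_fiber i : #|[set w | lam i w \in B]| = #|B| * #|F|.
Proof.
have [j ij] : exists j, i != j.
  have /card_gt1P[j [k [_ _ jk]]] := I_gt1.
  by have [->|] := eqVneq i j; [exists k | exists j].
rewrite -[#|F|]cardsT -(card_orthogonal_pair setT ij).
by apply: eq_card => w; rewrite !inE andbT.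
Qed.

Lemma sum_hits : \sum_w hits w = #|I| * (#|B| * #|F|).
Proof.
rewrite /hits; under eq_bigr => w _ do rewrite -sum1dep_card.
rewrite (exchange_big_dep predT) //= -sum_nat_const; apply: eq_bigr => i _.
by rewrite sum1dep_card card_orthogonal_fiber.
Qed.

Lemma sum_hits_sqr :
  \sum_w hits w ^ 2 = #|I| * (#|B| * #|F|) + #|I| * (#|I|.-1 * #|B| ^ 2).
Proof.
have -> : \sum_w hits w ^ 2 = \sum_i \sum_j #|[set w | (lam i w \in B) && (lam j w \in B)]|.
  transitivity (\sum_w \sum_i \sum_j ((lam i w \in B) && (lam j w \in B) : nat)).
    apply: eq_bigr => w _; rewrite -mulnn /hits -sum1dep_card big_mkcond big_distrlr /=.
    by apply: eq_bigr => i _; apply: eq_bigr => j _; do 2!case: (_ \in B).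
  rewrite exchange_big /=; apply: eq_bigr => i _; rewrite exchange_big /=; apply: eq_bigr => j _.
  by rewrite -sum1dep_card [RHS]big_mkcond; apply: eq_bigr => w _; case: andb.
rewrite -mulnDr -[RHS]sum_nat_const; apply: eq_bigr => i _.
rewrite (bigD1 i) //= (eq_bigr (fun _ => #|B| ^ 2)) => [|j ji]; last first.
  by rewrite card_orthogonal_pair 1?eq_sym ?mulnn.
rewrite sum_nat_const cardC1 -(card_orthogonal_fiber i); congr (_ + _).
by apply: eq_card => w; rewrite !inE andbb.
Qed.

(** A second-moment bound: [hits] has mean |I| |B| / |F|, and distinct classes are uncorrelated.
    Over all of W the sum falls short of the right side by |I| (|F| |B|)^2. *)
Lemma orthogonal_variance (U : {set W}) :
  (\sum_(w in U) ((#|F| * hits w)%:R - (#|I| * #|B|)%:R) ^+ 2 <=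
   (#|F| ^ 3 * (#|I| * #|B|))%:R :> int)%R.
Proof.
apply: (@Order.POrderTheory.le_trans _ _
  (\sum_w ((#|F| * hits w)%:R - (#|I| * #|B|)%:R) ^+ 2)%R).
  rewrite [leRHS](bigID (mem U)) /= lerDl; apply: sumr_ge0 => w _; exact: sqr_ge0.
have -> : (\sum_w ((#|F| * hits w)%:R - (#|I| * #|B|)%:R) ^+ 2 =
   (#|F| ^ 2)%:R * (\sum_w hits w ^ 2)%:R - (2 * #|F| * (#|I| * #|B|))%:R * (\sum_w hits w)%:R
   + ((#|I| * #|B|) ^ 2 * #|F| ^ 2)%:R :> int)%R.
  rewrite !natr_sum !mulr_sumr.
  have -> : (((#|I| * #|B|) ^ 2 * #|F| ^ 2)%:R = \sum_(w : W) ((#|I| * #|B|) ^ 2)%:R :> int)%R.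
    by rewrite -cardW sumr_const mulnC natrM mulr_natl.
  rewrite -sumrB -big_split /=; apply: eq_bigr => w _.
  by rewrite !(natrM, natrX); ring.
rewrite sum_hits sum_hits_sqr; case: #|I| I_gt1 => // n _ /=.
rewrite !(natrD, natrM, natrX) -!natr1.
set f := (#|F|%:R)%R; set b := (#|B|%:R)%R; set m := (n%:R)%R.
have -> : (f ^+ 3 * ((m + 1) * b) = 
  f ^+ 2 * ((m + 1) * (b * f)) :> int)%R by ring.
rewrite -subr_ge0.
rewrite [leRHS](_ : _ = (m + 1) * (f * b) ^+ 2)%R; last by ring.
by rewrite mulr_ge0 ?sqr_ge0 // addr_ge0 // ler0n.
Qed.

(** A point without hits deviates from the scaled mean by all of |I| |B|. *)
Lemma orthogonal_missing (U : {set W}) :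
  (forall w i, w \in U -> lam i w \notin B) -> #|U| * (#|I| * #|B|) <= #|F| ^ 3.
Proof.
move=> UB; have := orthogonal_variance U.
rewrite (eq_bigr (fun _ => ((#|I| * #|B|) ^ 2)%:R)%R) => [|w wU]; last first.
  rewrite (_ : hits w = 0) ?muln0 ?sub0r ?sqrrN ?natrX //.
  by apply/eqP; rewrite cards_eq0; apply/eqP/setP=> i; rewrite !inE (negbTE (UB w i wU)).
rewrite sumr_const -mulrnA ler_nat mulnC.
have [->|c0] := posnP (#|I| * #|B|); first by rewrite !muln0.
by rewrite -mulnn mulnA leq_pmul2r.
Qed.

(** A point hit in every class deviates by |I| (|F| - |B|), at least half of |I| |F|. *)
Lemma orthogonal_covered (U : {set W}) :
  (forall w i, w \in U -> lam i w \in B) -> 2 * #|B| <= #|F| ->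
  #|U| * #|I| <= 4 * (#|F| * #|B|).
Proof.
move=> UB BF; have := orthogonal_variance U.
rewrite (eq_bigr (fun _ => ((#|I| * (#|F| - #|B|)) ^ 2)%:R)%R) => [|w wU]; last first.
  rewrite (_ : hits w = #|I|); last first.
    by rewrite -cardsT; apply: eq_card => i; rewrite !inE UB.
  by rewrite mulnC -natrB ?leq_mul2l ?max_card ?orbT // -mulnBr natrX.
rewrite sumr_const -mulrnA ler_nat mulnC => h.
have [F0|F0] := posnP #|F|.
  suff -> : #|U| = 0 by [].
  by apply/eqP; rewrite -leqn0; apply: leq_trans (max_card _) _; rewrite cardW F0.
have I0 : 0 < #|I| by apply: leq_trans I_gt1.
have h2 : #|U| * (#|I| * (#|I| * #|F| ^ 2)) <= 4 * (#|F| ^ 3 * (#|I| * #|B|)).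
  apply: leq_trans (_ : 4 * (#|U| * (#|I| * (#|F| - #|B|)) ^ 2) <= _); last by rewrite leq_mul2l h orbT.
  have : #|F| <= 2 * (#|F| - #|B|) by lia.
  move: (#|F| - #|B|) => e fe.
  have : #|F| ^ 2 <= 4 * e ^ 2 by rewrite -(expnMn 2 e 2) leq_exp2r.
  rewrite expnMn; nia.
have c0 : 0 < #|I| * #|F| ^ 2 by rewrite muln_gt0 I0 expn_gt0 F0.
rewrite -(leq_pmul2r c0); move: h2; rewrite (expnD _ 2 1); nia.
Qed.

End OrthogonalFamily.

(** * Divisibility of orbits by p *)

Section Divisibility.
Variable F : finFieldType.
Local Open Scope ring_scope.
Implicit Types (P : F * F * F) (O : {set F * F * F}).

Definition swap12 P := (P.1.2, P.1.1, P.2).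
Definition swap23 P := (P.1.1, P.2, P.1.2).
Definition vieta_move P := (P.1.1, P.1.2, P.1.1 * P.1.2 - P.2).
Definition rotation P := (P.1.1, P.2, P.1.1 * P.2 - P.1.2).

Definition on_markoff P :=
  P.1.1 ^+ 2 + P.1.2 ^+ 2 + P.2 ^+ 2 == P.1.1 * P.1.2 * P.2.
Definition markoff_points : {set F * F * F} :=
  [set P | on_markoff P && (P != (0, 0, 0))].

Definition stable O := forall P, P \in O ->
  [/\ swap12 P \in O, swap23 P \in O & vieta_move P \in O].

Lemma stable_rot O P : stable O -> P \in O -> rotation P \in O.
Proof. by move=> st PO; have [_ h _] := st _ PO; have [_ _] := st _ h. Qed.

Lemma stable_iter_rot O P n : stable O -> P \in O -> iter n rotation P \in O.
Proof. by move=> st PO; elim: n => //= n; apply: stable_rot. Qed.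

Lemma rot_inj : injective rotation.
Proof.
move=> [[x y] z] [[x' y'] z'] [-> <-].
by move/addrI/oppr_inj ->.
Qed.

Lemma sum_stable (V : zmodType) O (h : F * F * F -> F * F * F) (f : F * F * F -> V) :
  injective h -> (forall P, P \in O -> h P \in O) ->
  \sum_(P in O) f (h P) = \sum_(P in O) f P.
Proof.
move=> hI hO; have eO : h @: O = O.
  apply/eqP; rewrite eqEcard card_imset // leqnn andbT.
  by apply/subsetP=> _ /imsetP[P PO ->]; apply: hO.
by rewrite -{2}eO big_imset //= => P Q _ _; apply: hI.
Qed.

(* z/(xy) along the rotation (x,y,z) |-> (x,z,xz-y) telescopes to x/(yz), and
   the equation of the surface says that the three such fractions add up to 1;
   since 0^-1 = 0 the points with a vanishing coordinate must be added by hand. *)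
Lemma card_stable O : stable O -> O \subset markoff_points -> #|O|%:R = 0 :> F.
Proof.
move=> st sO.
pose f P : F := P.2 / (P.1.1 * P.1.2).
pose h P : F := P.1.1 / (P.1.2 * P.2) + (P.1.2 == 0)%:R.
pose c P := (P.1.2, P.2, P.1.1) : F * F * F.
have memO P : P \in O -> on_markoff P /\ P != (0, 0, 0).
  by move/(subsetP sO); rewrite inE => /andP[].
have sqr_neq0 (a b : F) : a ^+ 2 + b ^+ 2 = 0 -> (a == 0) = (b == 0).
  move=> e; rewrite -(sqrf_eq0 a) -(sqrf_eq0 b).
  by rewrite -[a ^+ 2](addrK (b ^+ 2)) e sub0r oppr_eq0.
have sumh : \sum_(P in O) h P = 0.
  have -> : \sum_(P in O) h P = \sum_(P in O) (f (rotation P) - f P).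
    apply: eq_bigr => -[[x y] z] /memO[]; rewrite /on_markoff /h /f /rotation /= => /eqP e n0.
    have [x0|x0] := eqVneq x 0.
      have [y0|y0] := eqVneq y 0.
        move: e n0; rewrite x0 y0 !expr0n /= !mul0r !add0r => /eqP.
        by rewrite sqrf_eq0 => /eqP ->; rewrite eqxx.
      by rewrite x0 !(mulr0, mul0r, invr0, subr0, addr0).
    (* At y = 0 the next point is (x, z, xz), whose fraction [f] is 1: this is the indicator added
       in [h]. *)
    have [y0|y0] := eqVneq y 0.
      have z0 : z != 0.
        rewrite -(sqr_neq0 x z) //.
        by move: e; rewrite y0 expr0n addr0 mulr0 mul0r.
      by rewrite y0 !(mul0r, mulr0, invr0, subr0, add0r) divff // mulf_neq0.
    have [z0|z0] := eqVneq z 0.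
      by rewrite z0 !(mulr0, mul0r, invr0, subr0, addr0).
    rewrite addr0; apply: (mulfI (mulf_neq0 (mulf_neq0 x0 y0) z0)).
    have -> : x * y * z * (x / (y * z)) = x ^+ 2 by field; rewrite ?x0 ?y0 ?z0.
    have -> : x * y * z * ((x * z - y) / (x * z) - z / (x * y)) = x * y * z - y ^+ 2 - z ^+ 2.
      by field; rewrite ?x0 ?y0 ?z0.
    by rewrite -e; ring.
  by rewrite sumrB (sum_stable f rot_inj) ?subrr // => P; apply: stable_rot.
have c_inj : injective c by move=> [[? ?] ?] [[? ?] ?] [-> -> ->].
have cO P : P \in O -> c P \in O.
  by move=> PO; have [/st[]] := st _ PO.
rewrite -sumr_const.
(* Each point contributes 1: with nonzero coordinates this is the equation divided by xyz; otherwise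
   exactly one coordinate vanishes, so one indicator is 1 and the fractions are 0. *)
transitivity (\sum_(P in O) (h P + h (c P) + h (c (c P)))).
  apply: eq_bigr => -[[x y] z] /memO[]; rewrite /on_markoff /h /c /= => /eqP e n0.
  have [x0|x0] := eqVneq x 0.
    have y0 : y != 0.
      apply: contra_neq n0 => y0; move: e; rewrite x0 y0 !expr0n /= !mul0r !add0r => /eqP.
      by rewrite sqrf_eq0 => /eqP ->.
    have z0 : z != 0.
      by rewrite -(sqr_neq0 y z) //; move: e; rewrite x0 expr0n add0r !mul0r.
    by rewrite (negbTE y0) (negbTE z0) x0 !(mul0r, mulr0, invr0, addr0, add0r).
  have [y0|y0] := eqVneq y 0.
    have z0 : z != 0.
      by rewrite -(sqr_neq0 x z) //; move: e; rewrite y0 expr0n addr0 mulr0 mul0r.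
    by rewrite (negbTE z0) y0 !(mul0r, mulr0, invr0, addr0, add0r).
  have [z0|z0] := eqVneq z 0.
    by rewrite z0 !(mul0r, mulr0, invr0, addr0, add0r).
  rewrite !addr0.
  have -> : x / (y * z) + y / (z * x) + z / (x * y) = (x ^+ 2 + y ^+ 2 + z ^+ 2) / (x * y * z).
    by field; rewrite ?x0 ?y0 ?z0.
  by rewrite e divff // !mulf_neq0.
have s1 : \sum_(P in O) h (c P) = 0 := etrans (sum_stable h c_inj cO) sumh.
have s2 : \sum_(P in O) h (c (c P)) = 0 := etrans (sum_stable (h \o c) c_inj cO) s1.
by rewrite big_split /= s2 addr0 big_split /= sumh s1 addr0.
Qed.

End Divisibility.

(** * Rotations *)

Lemma prim_root_neq0 (K : fieldType) n (z : K) : (n.-primitive_root z -> z != 0)%R.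
Proof.
move=> zP; apply: contra_eqN (prim_expr_order zP) => /eqP ->.
by rewrite expr0n gtn_eqF ?(prim_order_gt0 zP) // eq_sym oner_eq0.
Qed.

Section Rotation.
Variables (F K : fieldType) (iota : {rmorphism F -> K}).
Local Open Scope ring_scope.

(** The Chebyshev recurrence s_(n+2) = x s_(n+1) - s_n from s_0 = y, s_1 = z: the coordinates met by
    successive rotations about x. *)
Definition rotation_seq (x y z : F) n : F := (iter n (fun u : F * F => (u.2, x * u.2 - u.1)) (y, z)).1.

(** w and v are the roots of t^2 - x t + 1, which may lie outside F; A and B are solved from the
    first two terms. *)
Lemma rotation_seq_closed x y z w v : w * v = 1 -> iota x = w + v -> w != v ->
  exists A B, forall n, iota (rotation_seq x y z n) = A * w ^+ n + B * v ^+ n.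
Proof.
move=> wv ex nwv; have d0 : w - v != 0 by rewrite subr_eq0.
exists ((iota z - v * iota y) / (w - v)), ((w * iota y - iota z) / (w - v)) => n.
set A := _ / _; set B := _ / _.
suff [] : iota (rotation_seq x y z n) = A * w ^+ n + B * v ^+ n /\
    iota ((iter n (fun u : F * F => (u.2, x * u.2 - u.1)) (y, z)).2) =
      A * w ^+ n.+1 + B * v ^+ n.+1 by [].
rewrite /rotation_seq; elim: n => [|n [IH1 IH2]] /=.
  by split; rewrite ?expr0 ?expr1 /A /B; field.
split=> //; rewrite rmorphB rmorphM IH1 IH2 ex !exprS.
transitivity (A * (w * (w * w ^+ n)) + B * (v * (v * v ^+ n)) +
   (w * v - 1) * (A * w ^+ n + B * v ^+ n)); first by ring.
by rewrite wv subrr mul0r addr0.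
Qed.

Lemma exp_sum_inj (w v A B A' B' : K) : w != v ->
  A + B = A' + B' -> A * w + B * v = A' * w + B' * v -> A = A' /\ B = B'.
Proof.
move=> nwv e0 e1; have d0 : w - v != 0 by rewrite subr_eq0.
have eA : A = A'.
  apply/eqP; rewrite -subr_eq0 -(mulrI_eq0 _ (mulfI d0)); apply/eqP.
  transitivity ((A * w + B * v) - (A' * w + B' * v) - v * ((A + B) - (A' + B'))); first by ring.
  by rewrite e0 e1 !subrr mulr0 subrr.
by split=> //; move: e0; rewrite eA => /addrI.
Qed.

End Rotation.

Lemma iter_rotE (F : finFieldType) (P : F * F * F) n :
  iter n (@rotation F) P = (P.1.1, rotation_seq P.1.1 P.1.2 P.2 n, rotation_seq P.1.1 P.1.2 P.2 n.+1)%R.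
Proof.
case: P => [[x y] z] /=; elim: n => [|n IH] //.
by rewrite iterS IH /rotation /rotation_seq /=.
Qed.

(** For a stable set first coordinates suffice, because the swaps move every coordinate to the first
    place. *)
Definition coords (F : finFieldType) (O : {set F * F * F}) : {set F} := [set P.1.1 | P in O].

Lemma coords2 (F : finFieldType) (O : {set F * F * F}) P :
  stable O -> P \in O -> P.1.2 \in coords O.
Proof. by move=> st PO; have [h _ _] := st _ PO; apply/imsetP; exists (swap12 P). Qed.

(** * Conics of coordinates of one order, glued into the plane *)

Section Class.
Variables (F : finFieldType) (K : fieldType) (iota : {rmorphism F -> K}).
Local Open Scope ring_scope.
Variables (O : {set F * F * F}) (h : nat) (zeta : K) (x0 : F).
Hypothesis two_neq0 : 2 != 0 :> F.
Hypothesis O_stable : stable O.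
Hypothesis O_sub : O \subset markoff_points F.
Hypothesis zeta_prim : h.-primitive_root zeta.
Hypothesis zeta_sqr : zeta ^+ 2 != 1.
Hypothesis x0E : iota x0 = zeta + zeta^-1.

Let zeta0 : zeta != 0.
Proof. exact: prim_root_neq0 zeta_prim. Qed.

Let zetaV : zeta * zeta^-1 = 1.
Proof. by rewrite divff. Qed.

Let zeta_neqV : zeta != zeta^-1.
Proof.
by apply: contra_neq zeta_sqr => e; rewrite expr2 {2}e.
Qed.

(* Rotations around the various x of order h are powers of one torus element, the
   companion matrix of x0, once their conics are mapped to the plane by [plane]:
   [ell_plane] says that the linear form [ell _ n] then reads off a power of the
   rotation. *)
Definition ell (u : F * F) n : F := rotation_seq x0 u.1 u.2 n.

Lemma ell_closed u : exists A B, forall n, iota (ell u n) = A * zeta ^+ n + B * zeta^-1 ^+ n.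
Proof. exact: rotation_seq_closed zetaV x0E zeta_neqV. Qed.

(** [ell u n] is zeta^-n (A zeta^(2n) + B) in eigen-coordinates A, B of u; two distinct values of
    zeta^(2n) determine A and B. *)
Lemma ell_inj i j : zeta ^+ (2 * i) != zeta ^+ (2 * j) ->
  injective (fun u => (ell u i, ell u j)).
Proof.
move=> nij u v [ei ej].
have [A [B uE]] := ell_closed u; have [A' [B' vE]] := ell_closed v.
have key n : ell u n = ell v n -> (A - A') * zeta ^+ (2 * n) + (B - B') = 0.
  move=> /(congr1 iota); rewrite uE vE => e.
  have z0 : zeta^-1 ^+ n != 0 by rewrite expf_neq0 // invr_eq0.
  apply: (mulIf z0); rewrite mul0r mulrDl -mulrA mul2n -addnn exprD -[X in _ * X]mulrA -exprMn zetaV expr1n mulr1.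
  by rewrite !mulrBl; move/eqP: e; rewrite -subr_eq0 => /eqP <-; ring.
have eA : A = A'.
  have : (A - A') * (zeta ^+ (2 * i) - zeta ^+ (2 * j)) = 0.
    by transitivity (((A - A') * zeta ^+ (2 * i) + (B - B')) - ((A - A') * zeta ^+ (2 * j) + (B - B')));
      [ring | rewrite !key // subrr].
  move/eqP; rewrite mulf_eq0 (subr_eq0 (zeta ^+ _)) (negbTE nij) orbF subr_eq0.
  by move/eqP.
have eB : B = B' by have := key i ei; rewrite eA subrr mul0r add0r => /eqP; rewrite subr_eq0 => /eqP.
have e n : ell u n = ell v n by apply: (fmorph_inj iota); rewrite uE vE eA eB.
rewrite (surjective_pairing u) (surjective_pairing v).
by congr pair; [exact: (e 0%N) | exact: (e 1%N)].
Qed.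

(** For u = (j, e), x is the trace of zeta^j, and zeta^(j e) = zeta says that zeta^j again has order
    h, e inverting j modulo h. *)
Definition order_class_index (x : F) (u : 'I_h * 'I_h) :=
  (iota x == zeta ^+ u.1 + zeta^-1 ^+ u.1) && (zeta ^+ (u.1 * u.2) == zeta).

Definition order_class : {set F} := [set x in coords O | [exists u, order_class_index x u]].

Let idx x := odflt (Ordinal (prim_order_gt0 zeta_prim), Ordinal (prim_order_gt0 zeta_prim))
  [pick u | order_class_index x u].

Lemma order_class_idx x : x \in order_class -> order_class_index x (idx x).
Proof.
rewrite inE => /andP[_ /existsP[u hu]]; rewrite /idx.
by case: pickP => [//|/(_ u)]; rewrite hu.
Qed.

(** Terms 0 and e of the rotation sequence of P. As w^e = zeta for the eigenvalue w, they serve as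
    terms 0 and 1 of a sequence for [x0]. *)
Definition plane P : F * F := (P.1.2, rotation_seq P.1.1 P.1.2 P.2 (idx P.1.1).2).

Let W : {set F * F * F} := [set P in O | P.1.1 \in order_class].
Definition plane_set : {set F * F} := plane @: W.

Lemma order_class_closed P : P \in W -> exists w v A B,
  [/\ w * v = 1, iota P.1.1 = w + v, w != v, w ^+ (idx P.1.1).2 = zeta &
   v ^+ (idx P.1.1).2 = zeta^-1] /\
  [/\ w = zeta ^+ (idx P.1.1).1, v = zeta^-1 ^+ (idx P.1.1).1 & forall n, iota (rotation_seq P.1.1 P.1.2 P.2 n) = A * w ^+ n + B * v ^+ n].
Proof.
rewrite inE => /andP[_ /order_class_idx /andP[/eqP ex /eqP ej]].
set j := (idx _).1 in ex ej *; set e := (idx _).2 in ej *.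
pose w := zeta ^+ j; pose v := zeta^-1 ^+ j.
have wv : w * v = 1 by rewrite -exprMn zetaV expr1n.
have we : w ^+ e = zeta by rewrite -exprM.
have ve : v ^+ e = zeta^-1 by rewrite -exprM exprVn ej.
have nwv : w != v.
  by apply: contra_neq zeta_neqV => ewv; rewrite -ve -ewv we.
have [A [B hAB]] := rotation_seq_closed P.1.2 P.2 wv ex nwv.
by exists w, v, A, B; split; split.
Qed.

Lemma ell_plane P n : P \in W -> ell (plane P) n = rotation_seq P.1.1 P.1.2 P.2 ((idx P.1.1).2 * n).
Proof.
move=> PW; have [w [v [A [B [[wv ex nwv we ve] [_ _ hAB]]]]]] := order_class_closed PW.
have [A' [B' hE]] := ell_closed (plane P).
have [] := @exp_sum_inj _ zeta zeta^-1 A B A' B' zeta_neqV.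
- by have := etrans (esym (hAB 0%N)) (hE 0%N); rewrite !expr0 !mulr1.
- by have := etrans (esym (hAB (idx P.1.1).2)) (hE 1%N); rewrite !expr1 we ve.
by move=> eA eB; apply: (fmorph_inj iota); rewrite hE hAB !exprM we ve eA eB.
Qed.

Lemma ell_plane_coords u n : u \in plane_set -> ell u n \in coords O.
Proof.
case/imsetP=> P PW ->; rewrite ell_plane //.
have PO : P \in O by move: PW; rewrite inE => /andP[].
have := coords2 O_stable (stable_iter_rot ((idx P.1.1).2 * n) O_stable PO).
by rewrite iter_rotE.
Qed.

Lemma zeta_expI n m : (n < h)%N -> (m < h)%N -> zeta ^+ n = zeta ^+ m -> n = m.
Proof.
by move=> nh mh /eqP; rewrite (eq_prim_root_expr zeta_prim) !modn_small // => /eqP.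
Qed.

(** The first h iterates of the rotation about each x of the class are distinct points of O: if they
    coincide for n and m, comparing the A terms or the B terms gives n = m, and A = B = 0 would give
    y = z = 0, hence x = 0. *)
Lemma leq_card_order_class : (#|order_class| * h <= #|W|)%N.
Proof.
have -> : W = [set P in W | P.1.1 \in order_class] 
  by apply/setP=> P; rewrite [RHS]in_set; symmetry; apply: andb_idr; rewrite in_set => /andP[].
rewrite card_fibers -sum_nat_const; apply: leq_sum => x xC.
have [P0 P0O ex] : exists2 P, P \in O & x = P.1.1.
  by move: xC; rewrite inE => /andP[/imsetP[P PO ->] _]; exists P.
rewrite -[X in (X <= _)%N]card_ord -(card_in_imset (f := fun n : 'I_h => iter n (@rotation F) P0) (D := 'I_h)).
  apply/subset_leq_card/subsetP=> _ /imsetP[n _ ->].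
  have nW : iter n (@rotation F) P0 \in W.
    by rewrite in_set; apply/andP; split; [exact: stable_iter_rot | rewrite iter_rotE /= -ex].
  by rewrite in_set nW iter_rotE /= -ex eqxx.
have P0W : P0 \in W by rewrite in_set P0O -ex.
have [w [v [A [B [[wv eX nwv we ve] [_ _ hAB]]]]]] := order_class_closed P0W.
move=> n m _ _ /=; rewrite !iter_rotE => -[e0 e1].
move/(congr1 iota): e0; move/(congr1 iota): e1; rewrite !hAB => e1 e0.
have [||eA eB] := @exp_sum_inj _ w v (A * w ^+ n) (B * v ^+ n) (A * w ^+ m) (B * v ^+ m) nwv.
- exact: e0.
- by move: e1; rewrite !exprSr !mulrA.
have [A0|A0] := eqVneq A 0; last first.
  apply: val_inj; apply: (zeta_expI (ltn_ord n) (ltn_ord m)).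
  by rewrite -we -!exprM mulnC exprM (mulfI A0 eA) -exprM mulnC.
have [B0|B0] := eqVneq B 0; last first.
  apply: val_inj; apply: (zeta_expI (ltn_ord n) (ltn_ord m)); apply: invr_inj.
  by rewrite -!exprVn -ve -!exprM mulnC exprM (mulfI B0 eB) -exprM mulnC.
have y0 : P0.1.2 = 0.
  by apply: (fmorph_inj iota); have := hAB 0%N; rewrite A0 B0 !mul0r addr0 rmorph0.
have z0 : P0.2 = 0.
  by apply: (fmorph_inj iota); have := hAB 1%N; rewrite A0 B0 !mul0r addr0 rmorph0.
have := subsetP O_sub _ P0O; rewrite inE /on_markoff (surjective_pairing P0) (surjective_pairing P0.1) /= y0 z0.
by rewrite !expr0n /= !mulr0 !addr0 sqrf_eq0 => /andP[/eqP ->]; rewrite eqxx.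
Qed.

Lemma order_class_conic P : P \in W -> exists w v A B,
  [/\ w = zeta ^+ (idx P.1.1).1, v = zeta^-1 ^+ (idx P.1.1).1, iota P.1.2 = A + B & iota P.2 = A * w + B * v] /\
  iota (plane P).2 = A * zeta + B * zeta^-1 /\
  (iota P.1.1) ^+ 2 = A * B * ((iota P.1.1) ^+ 2 - 4).
Proof.
move=> PW; have [w [v [A [B [[wv eX nwv we ve] [ew ev hAB]]]]]] := order_class_closed PW.
have ey : iota P.1.2 = A + B by have := hAB 0%N; rewrite !expr0 !mulr1.
have ez : iota P.2 = A * w + B * v by have := hAB 1%N; rewrite !expr1.
exists w, v, A, B; split; [by split | split; first by rewrite /plane /= hAB we ve].
have : P \in markoff_points F by apply: (subsetP O_sub); move: PW; rewrite inE => /andP[].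
rewrite inE /on_markoff => /andP[/eqP /(congr1 iota)].
rewrite !rmorphD !rmorphXn !rmorphM /= => eM _; move: eM; rewrite ey ez eX => /eqP.
rewrite -subr_eq0 => /eqP eM; apply/eqP; rewrite -subr_eq0 -eM; apply/eqP.
transitivity ((w + v) ^+ 2 + (A + B) ^+ 2 + (A * w + B * v) ^+ 2 -
  (w + v) * (A + B) * (A * w + B * v) - (1 - w * v) * (A - B) ^+ 2); first by ring.
by rewrite wv subrr mul0r subr0.
Qed.

(** A point of the plane determines A and B. The surface equation (1 - A B) x^2 = -4 A B then gives
    x up to sign, because A B = 1 would mean 4 = 0, and x determines z. *)
Lemma leq_card_plane : (#|W| <= 2 * #|plane_set|)%N.
Proof.
have -> : W = [set P in W | plane P \in plane_set].
  by apply/setP=> P; rewrite [RHS]inE; symmetry; apply: andb_idr => PW; apply: imset_f.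
rewrite card_fibers mulnC -sum_nat_const; apply: leq_sum => u /imsetP[P1 P1W ->].
apply: leq_trans (_ : #|[set P1.1.1; - P1.1.1]| <= _)%N; last first.
  by rewrite cards2; case: eqP.
rewrite -[X in (X <= _)%N](card_in_imset (f := fun P : F * F * F => P.1.1)); last first.
  move=> P Q; rewrite [P \in _]in_set [Q \in _]in_set => /andP[PW /eqP eP] /andP[QW /eqP eQ] eX.
  have [w [v [A [B [[ew ev ey ez] [e2 _]]]]]] := order_class_conic PW.
  have [w' [v' [A' [B' [[ew' ev' ey' ez'] [e2' _]]]]]] := order_class_conic QW.
  have ePQ : plane P = plane Q by rewrite eP eQ.
  have e12 : P.1.2 = Q.1.2 by case: ePQ.
  have [||eA eB] := @exp_sum_inj _ zeta zeta^-1 A B A' B' zeta_neqV.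
  - by rewrite -ey -ey' e12.
  - by rewrite -e2 -e2' ePQ.
  have e3 : P.2 = Q.2.
    by apply: (fmorph_inj iota); rewrite ez ez' ew ev ew' ev' eA eB eX.
  by move: eX e12 e3; clear; case: P Q => [[? ?] ?] [[? ?] ?] /= -> -> ->.
apply/subset_leq_card/subsetP=> y /imsetP[P]; rewrite in_set => /andP[PW /eqP eP] -> {y}.
have [w [v [A [B [[ew ev ey ez] [e2 hP]]]]]] := order_class_conic PW.
have [w' [v' [A' [B' [[ew' ev' ey' ez'] [e2' hP1]]]]]] := order_class_conic P1W.
have e12 : P.1.2 = P1.1.2 by case: eP.
have [||eA eB] := @exp_sum_inj _ zeta zeta^-1 A B A' B' zeta_neqV.
- by rewrite -ey -ey' e12.
- by rewrite -e2 -e2' eP.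
have nc : 1 - A * B != 0.
  apply/eqP=> /eqP; rewrite subr_eq0 => /eqP c1; move/eqP: hP.
  rewrite -c1 mul1r -subr_eq0 opprD addrA subrr add0r opprK.
  have -> : 4 = iota (2 * 2) by rewrite rmorphM rmorph_nat -natrM.
  by rewrite fmorph_eq0 mulf_eq0 (negbTE two_neq0).
have : (1 - A * B) * iota (P.1.1 ^+ 2 - P1.1.1 ^+ 2) = 0.
  rewrite rmorphB !rmorphXn /= mulrBr !mulrBl !mul1r {1}hP {2}eA {2}eB {1}hP1 eA eB; ring.
move/eqP; rewrite mulf_eq0 (negbTE nc) fmorph_eq0 /= subr_eq0 eqf_sqr.
by rewrite !inE.
Qed.

Lemma card_plane_set : (#|order_class| * h <= 2 * #|plane_set|)%N.
Proof. exact: leq_trans leq_card_order_class leq_card_plane. Qed.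

End Class.

(** * Sines and cosines *)

Section Trig.
Variables (F : finFieldType) (K : fieldType) (iota : {rmorphism F -> K}).
Local Open Scope ring_scope.
Variables (h : nat) (zeta : K) (x0 : F).
Hypothesis zeta_prim : h.-primitive_root zeta.
Hypothesis zeta_sqr : zeta ^+ 2 != 1.
Hypothesis x0E : iota x0 = zeta + zeta^-1.

Let zeta0 : zeta != 0.
Proof. exact: prim_root_neq0 zeta_prim. Qed.

Let zetaV : zeta * zeta^-1 = 1.
Proof. by rewrite divff. Qed.

Let zeta_neqV : zeta != zeta^-1.
Proof. by apply: contra_neq zeta_sqr => e; rewrite expr2 {2}e. Qed.

Let delta_neq0 : zeta - zeta^-1 != 0.
Proof. by rewrite subr_eq0. Qed.

Let zetaX n : zeta ^+ n * zeta^-1 ^+ n = 1.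
Proof. by rewrite -exprMn zetaV expr1n. Qed.

Let h_gt0 : (0 < h)%N := prim_order_gt0 zeta_prim.

(* Even angles in [tcos], so that the difference of two cosines is a product of
   two sines of integral index. *)
Definition usin n : F := rotation_seq x0 0 1 n.
Definition tcos n : F := rotation_seq x0 2 x0 (2 * n).

Lemma usinE n : (zeta - zeta^-1) * iota (usin n) = zeta ^+ n - zeta^-1 ^+ n.
Proof.
have [A [B hE]] := rotation_seq_closed 0 1 zetaV x0E zeta_neqV.
have [||eA eB] := @exp_sum_inj _ zeta zeta^-1 A B (zeta - zeta^-1)^-1 (- (zeta - zeta^-1)^-1) zeta_neqV.
- by have := hE 0%N; rewrite !expr0 !mulr1 => <-; rewrite rmorph0 subrr.
- have := hE 1%N; rewrite !expr1 => <-; rewrite rmorph1 mulNr -mulrBr mulVf //.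
by rewrite hE eA eB mulNr -mulrBr mulrA divff // mul1r.
Qed.

Lemma tcosE n : iota (tcos n) = zeta ^+ (2 * n) + zeta^-1 ^+ (2 * n).
Proof.
have [A [B hE]] := rotation_seq_closed 2 x0 zetaV x0E zeta_neqV.
have [||eA eB] := @exp_sum_inj _ zeta zeta^-1 A B 1 1 zeta_neqV.
- by have := hE 0%N; rewrite !expr0 !mulr1 => <-; rewrite rmorph_nat.
- by have := hE 1%N; rewrite !expr1 => <-; rewrite !mul1r.
by rewrite hE eA eB !mul1r.
Qed.

Let zeta_mod n : zeta ^+ (n %% h) = zeta ^+ n.
Proof. exact: prim_expr_mod. Qed.

Let zetaV_mod n : zeta^-1 ^+ (n %% h) = zeta^-1 ^+ n.
Proof. by rewrite !exprVn prim_expr_mod. Qed.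

Definition sin_set : {set F} := [set usin i | i : 'I_h] :\ 0.
Definition cos_set : {set F} := [set tcos i | i : 'I_h].

Lemma mem_sin_set n : usin n != 0 -> usin n \in sin_set.
Proof.
move=> n0; rewrite !inE n0; apply/imsetP; exists (Ordinal (ltn_pmod n h_gt0)) => //=.
apply/(fmorph_inj iota)/(mulfI delta_neq0).
by rewrite !usinE zeta_mod zetaV_mod.
Qed.

Lemma mem_cos_set n : tcos n \in cos_set.
Proof.
apply/imsetP; exists (Ordinal (ltn_pmod n h_gt0)) => //=.
by apply: (fmorph_inj iota); rewrite !tcosE !exprM !exprVn -!exprM mulnC [(2 * _)%N]mulnC !exprM zeta_mod.
Qed.

Let zeta_order i : (0 < i < h)%N -> zeta ^+ i != 1.
Proof.
case/andP=> i0 ih; rewrite -(prim_order_dvd zeta_prim); apply/negP=> /dvdn_leq.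
by move/(_ i0); rewrite leqNgt ih.
Qed.

(** The first ceil(h / 4) cosines are distinct: their differences factor through zeta^(2(i - j)) - 1
    and 1 - zeta^(-2(i + j)), with exponents below h in absolute value. *)
Lemma leq_card_cos_set : (h <= 4 * #|cos_set|)%N.
Proof.
pose k := ((h + 3) %/ 4)%N.
have kh i : (i < k)%N -> (4 * i < h)%N by rewrite /k; lia.
have inj : injective (fun i : 'I_k => tcos i).
  move=> i j /(congr1 iota); rewrite !tcosE => e; apply: val_inj => /=.
  wlog le_ij : i j e / (j <= i)%N.
    by move=> H; case: (leqP j i) => [|/ltnW] ?; [exact: H | symmetry; exact: H].
  have : (zeta ^+ (2 * i) - zeta ^+ (2 * j)) * (1 - zeta^-1 ^+ (2 * (i + j))) = 0.
    have := zetaX (2 * i); have := zetaX (2 * j); rewrite mulnDr exprD.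
    move: e; set a := zeta ^+ (2 * i); set b := zeta ^+ (2 * j).
    set c := zeta^-1 ^+ (2 * i); set d := zeta^-1 ^+ (2 * j) => e1 e2 e3.
    transitivity (a + c - (b + d) + c * (b * d - 1) - d * (a * c - 1)); first by ring.
    by rewrite e1 e2 e3 !subrr !mulr0 !subr0 addr0.
  move/eqP; rewrite mulf_eq0 => /orP[|].
    have [-> //|ne] := eqVneq (i : nat) j.
    have -> : zeta ^+ (2 * i) = zeta ^+ (2 * (i - j)) * zeta ^+ (2 * j).
      by rewrite -exprD -mulnDr subnK.
    rewrite -{2}[zeta ^+ (2 * j)]mul1r -mulrBl mulf_eq0 expf_eq0 (negbTE zeta0) andbF orbF subr_eq0.
    by rewrite (negbTE (zeta_order _)) //; have := kh i (ltn_ord i); lia.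
  rewrite subr_eq0 exprVn eq_sym invr_eq1.
  have [e0|e0] := posnP (i + j)%N; first by lia.
  by rewrite (negbTE (zeta_order _)) //; have := kh i (ltn_ord i); have := kh j (ltn_ord j); lia.
have : (k <= #|cos_set|)%N.
  rewrite -[X in (X <= _)%N]card_ord -(card_imset _ inj); apply/subset_leq_card/subsetP=> _ /imsetP[i _ ->].
  exact: mem_cos_set.
by rewrite /k; lia.
Qed.

Lemma usin_neq0 i : (0 < 2 * i < h)%N -> usin i != 0.
Proof.
move=> ih; apply/eqP=> u0; have := usinE i; rewrite u0 rmorph0 mulr0 => /esym/eqP.
rewrite subr_eq0 -(inj_eq (mulfI (expf_neq0 i zeta0))) zetaX -exprD addnn -mul2n.
exact/negP/zeta_order.
Qed.

(** As for the cosines, with indices starting at 1 to avoid the zero sine; the second factor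
    vanishes only if zeta^(i + j) = -1 for the shifted indices, which squaring excludes. *)
Lemma leq_card_sin_set : (h <= 4 * #|sin_set|.+1)%N.
Proof.
pose k := ((h + 3) %/ 4)%N.-1.
have kh i : (i < k)%N -> (4 * i.+1 < h)%N by rewrite /k; lia.
have inj : injective (fun i : 'I_k => usin i.+1).
  move=> i j /(congr1 iota)/(congr1 (fun x => (zeta - zeta^-1) * x)); rewrite !usinE => e; apply: val_inj => /=.
  wlog le_ij : i j e / (j <= i)%N.
    by move=> H; case: (leqP j i) => [|/ltnW] ?; [exact: H | symmetry; exact: H].
  have : (zeta ^+ i.+1 - zeta ^+ j.+1) * (1 + zeta^-1 ^+ (i.+1 + j.+1)) = 0.
    have := zetaX i.+1; have := zetaX j.+1; rewrite exprD.
    move: e; set a := zeta ^+ i.+1; set b := zeta ^+ j.+1.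
    set c := zeta^-1 ^+ i.+1; set d := zeta^-1 ^+ j.+1 => e1 e2 e3.
    transitivity (a - b - (c - d) - c * (b * d - 1) + d * (a * c - 1)); last first.
      by rewrite e2 e3 !subrr !mulr0 subr0 addr0; move/eqP: e1; rewrite -subr_eq0 => /eqP <-; ring.
    by ring.
  move/eqP; rewrite mulf_eq0 => /orP[|].
    have [-> //|ne] := eqVneq (i : nat) j.
    have -> : zeta ^+ i.+1 = zeta ^+ (i - j) * zeta ^+ j.+1.
      by rewrite -exprD addnS subnK.
    rewrite -{2}[zeta ^+ j.+1]mul1r -mulrBl mulf_eq0 expf_eq0 (negbTE zeta0) andbF orbF subr_eq0.
    by rewrite (negbTE (zeta_order _)) //; have := kh i (ltn_ord i); lia.
  rewrite addrC addr_eq0 => /eqP e1.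
  have : zeta^-1 ^+ (2 * (i.+1 + j.+1)) == 1 by rewrite mulnC exprM e1 sqrrN expr1n.
  rewrite exprVn invr_eq1.
  by rewrite (negbTE (zeta_order _)) //; have := kh i (ltn_ord i); have := kh j (ltn_ord j); lia.
have : (k <= #|sin_set|)%N.
  rewrite -[X in (X <= _)%N]card_ord -(card_imset _ inj); apply/subset_leq_card/subsetP=> _ /imsetP[i _ ->].
  by apply/mem_sin_set/usin_neq0; have := kh i (ltn_ord i); lia.
by rewrite /k; lia.
Qed.

(** The product formula for cosines of the angles i + j and i - j; i + (h - j) stands for i - j,
    since zeta^h = 1. *)
Lemma cos_setM a b : a \in cos_set -> b \in cos_set ->
  exists c d, [/\ c \in cos_set, d \in cos_set & a * b = c + d].
Proof.
case/imsetP=> i _ -> /imsetP[j _ ->].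
exists (tcos (i + j)), (tcos (i + (h - j))); split; rewrite ?mem_cos_set //.
have E (z : K) m n : z ^+ (2 * (m + n)) = z ^+ (2 * m) * z ^+ (2 * n) by rewrite mulnDr exprD.
apply: (fmorph_inj iota); rewrite rmorphM rmorphD !tcosE !E.
have -> : zeta ^+ (2 * (h - j)) = zeta^-1 ^+ (2 * j).
  apply: (mulIf (expf_neq0 (2 * j) zeta0)); rewrite -exprD -mulnDr subnK ?(ltnW (ltn_ord j)) //.
  by rewrite [(2 * h)%N]mulnC exprM (prim_expr_order zeta_prim) expr1n mulrC zetaX.
have -> : zeta^-1 ^+ (2 * (h - j)) = zeta ^+ (2 * j).
  apply: (mulIf (expf_neq0 (2 * j) (invr_neq0 zeta0))); rewrite -exprD -mulnDr subnK ?(ltnW (ltn_ord j)) //.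
  by rewrite exprVn [(2 * h)%N]mulnC exprM (prim_expr_order zeta_prim) expr1n invr1 zetaX.
ring.
Qed.

(** The sum-to-product formula, with x0^2 - 4 = (zeta - 1 / zeta)^2; both sines are nonzero because
    a != b. *)
Lemma cos_set_diff a b : a \in cos_set -> b \in cos_set -> a != b ->
  exists c d, [/\ c \in sin_set, d \in sin_set & a - b = (x0 ^+ 2 - 4) * (c * d)].
Proof.
case/imsetP=> i _ -> {a} /imsetP[j _ ->] {b} ne.
have eq : tcos i - tcos j = (x0 ^+ 2 - 4) * (usin (i + j) * usin (i + (h - j))).
  apply: (fmorph_inj iota); rewrite rmorphB rmorphM rmorphB rmorphXn rmorph_nat x0E rmorphM !tcosE.
  have -> : (zeta + zeta^-1) ^+ 2 - 4 = (zeta - zeta^-1) * (zeta - zeta^-1).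
    transitivity ((zeta - zeta^-1) * (zeta - zeta^-1) + 4 * (zeta * zeta^-1 - 1)); first by ring.
    by rewrite zetaV subrr mulr0 addr0.
  have E2 (z : K) n : z ^+ (2 * n) = z ^+ n * z ^+ n by rewrite mul2n -addnn exprD.
  rewrite mulrACA !usinE !E2 !(exprD _ i).
  have -> : zeta ^+ (h - j) = zeta^-1 ^+ j.
    apply: (mulIf (expf_neq0 j zeta0)); rewrite -exprD subnK ?(ltnW (ltn_ord j)) //.
    by rewrite (prim_expr_order zeta_prim) mulrC zetaX.
  have -> : zeta^-1 ^+ (h - j) = zeta ^+ j.
    apply: (mulIf (expf_neq0 j (invr_neq0 zeta0))); rewrite -exprD subnK ?(ltnW (ltn_ord j)) //.
    by rewrite exprVn (prim_expr_order zeta_prim) invr1 zetaX.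
  have := zetaX i; have := zetaX j.
  set a := zeta ^+ i; set b := zeta^-1 ^+ i.
  set c := zeta ^+ j; set d := zeta^-1 ^+ j => e1 e2.
  transitivity (a * a * (c * d) + b * b * (c * d) - (c * c * (a * b) + d * d * (a * b))); last by ring.
  by rewrite ?e1 ?e2 !mulr1.
exists (usin (i + j)), (usin (i + (h - j))).
have: usin (i + j) * usin (i + (h - j)) != 0.
  by apply: contra_neq ne => e0; apply/eqP; rewrite -subr_eq0 eq e0 mulr0.
by rewrite mulf_eq0 negb_or => /andP[n1 n2]; split; rewrite ?mem_sin_set.
Qed.

End Trig.

(** * Additive energy forced by three directions *)

Section Energy.
Variables (F : finFieldType) (K : fieldType) (iota : {rmorphism F -> K}).
Local Open Scope ring_scope.
Variables (h : nat) (zeta : K) (x0 : F).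
Hypothesis zeta_prim : h.-primitive_root zeta.
Hypothesis zeta_sqr : zeta ^+ 2 != 1.
Hypothesis x0E : iota x0 = zeta + zeta^-1.
Variables (X : {set F}) (U : {set F * F}).
Hypothesis U_ell : forall u n, u \in U -> ell x0 u n \in X.

Let zeta0 : zeta != 0.
Proof. exact: prim_root_neq0 zeta_prim. Qed.

Let zetaX n : zeta ^+ n * zeta^-1 ^+ n = 1.
Proof. by rewrite -exprMn divff // expr1n. Qed.

Let delta_neq0 : zeta - zeta^-1 != 0.
Proof. by rewrite subr_eq0; apply: contra_neq zeta_sqr => e; rewrite expr2 {2}e divff. Qed.

Let zeta_rev i : (i <= h)%N -> zeta ^+ (h - i) = zeta^-1 ^+ i.
Proof.
move=> ih; apply: (mulIf (expf_neq0 i zeta0)).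
by rewrite -exprD subnK // (prim_expr_order zeta_prim) mulrC zetaX.
Qed.

Let zetaV_rev i : (i <= h)%N -> zeta^-1 ^+ (h - i) = zeta ^+ i.
Proof. by move=> ih; rewrite exprVn zeta_rev // exprVn invrK. Qed.

(** A relation between the directions -i, 0 and j, where h - i stands for -i. *)
Lemma ell_three_term u i j : (i <= h)%N ->
  usin x0 j * ell x0 u (h - i) + usin x0 i * ell x0 u j = usin x0 (i + j) * ell x0 u 0%N.
Proof.
move=> ih; have [A [B hE]] := ell_closed zeta_prim zeta_sqr x0E u.
have sE := usinE zeta_prim zeta_sqr x0E.
apply: (fmorph_inj iota); apply: (mulfI delta_neq0).
rewrite rmorphD !rmorphM mulrDr !mulrA !sE !hE !expr0 (zeta_rev ih) (zetaV_rev ih) !(exprD _ i).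
have := zetaX i; have := zetaX j.
set a := zeta ^+ i; set b := zeta^-1 ^+ i; set c := zeta ^+ j; set d := zeta^-1 ^+ j => cd ab.
ring.
Qed.

(** Let a, b be the sines of i, j. By [ell_three_term], (s, t) to s + (a / b) t sends the
    projections of u in the directions -i and j into a fixed dilate of X. Cauchy-Schwarz on these
    |U| pairs bounds the energy below; excluding 1 and -1 keeps the two directions distinct. *)
Lemma energy_ratio a b : a \in sin_set h x0 -> b \in sin_set h x0 ->
  a / b != 1 -> a / b != - 1 -> (#|U| ^ 2 <= #|X| * energy X (a / b))%N.
Proof.
rewrite !inE => /andP[a0 /imsetP[i _ ea]] /andP[b0 /imsetP[j _ eb]] n1 nN1.
have sE := usinE zeta_prim zeta_sqr x0E.
have nij : zeta ^+ (2 * (h - i)) != zeta ^+ (2 * j).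
  have -> : zeta ^+ (2 * (h - i)) = zeta^-1 ^+ i * zeta^-1 ^+ i.
    by rewrite mul2n -addnn exprD zeta_rev // ltnW.
  apply/eqP=> e; have : (zeta^-1 ^+ i - zeta ^+ j) * (zeta^-1 ^+ i + zeta ^+ j) = 0.
    by rewrite mul2n -addnn exprD in e; rewrite -subr_sqr !expr2 e subrr.
  have hi := sE i; have hj := sE j; have zi := zetaX i; have zj := zetaX j.
  move/eqP; rewrite mulf_eq0 => /orP[].
    rewrite subr_eq0 => /eqP e1; case/eqP: nN1; rewrite ea eb in b0 *.
    apply: (mulIf b0); rewrite mulfVK // mulN1r; apply: (fmorph_inj iota); apply: (mulfI delta_neq0).
    rewrite rmorphN mulrN hi hj -e1 opprB.
    have -> // : zeta ^+ i = zeta^-1 ^+ j.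
    by apply: (mulIf (expf_neq0 j zeta0)); rewrite -e1 zi mulrC e1 zj.
  rewrite addr_eq0 => /eqP e1; case/eqP: n1; rewrite ea eb in b0 *.
  apply: (mulIf b0); rewrite mulfVK // mul1r; apply: (fmorph_inj iota); apply: (mulfI delta_neq0).
  rewrite hi hj e1 opprK.
  have -> : zeta ^+ i = - zeta^-1 ^+ j; last by rewrite addrC.
  apply: (mulIf (expf_neq0 j zeta0)); rewrite mulNr [_ * zeta ^+ j]mulrC [_ * zeta ^+ j in RHS]mulrC zj.
  by rewrite -[zeta ^+ j]opprK -e1 mulNr mulrC zi.
pose f (u : F * F) := (ell x0 u (h - i), ell x0 u j).
have f_inj : injective f := ell_inj zeta_prim zeta_sqr x0E nij.
pose c := usin x0 (i + j) / usin x0 j.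
have := sqr_card_leq_collisions (setX X X) (fun u => u.1 + (a / b) * u.2) [set c * x | x in X].
rewrite -/(energy X (a / b)) => hcs.
apply: leq_trans (leq_trans hcs _); last by rewrite leq_mul2r leq_imset_card orbT.
rewrite leq_exp2r // -(card_imset (mem U) f_inj); apply/subset_leq_card/subsetP=> _ /imsetP[u uU ->].
rewrite !inE /= !U_ell //=; apply/imsetP; exists (ell x0 u 0%N); first exact: U_ell.
rewrite eb in b0; rewrite ea eb /c; apply: (mulfI b0).
have E t : usin x0 j * (t / usin x0 j) = t by rewrite mulrC mulfVK.
rewrite mulrDr !(mulrA (usin x0 j) (_ / _)) !E.
by rewrite ell_three_term // ltnW.
Qed.

(** Sum [energy_ratio] over all ratios except 1 and -1 and compare with [sum_energy]. *)
Lemma card_sin_ratio :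
  ((#|[set (a / b)%R | a in sin_set h x0, b in sin_set h x0]| - 2) * #|U| ^ 2 <=
   #|X| * (#|X| ^ 4 + #|F| * #|X| ^ 2))%N.
Proof.
set R := [set _ | _ in _, _ in _]; pose E : {set F} := [set 1; -1].
apply: leq_trans (_ : #|R :\: E| * #|U| ^ 2 <= _)%N.
  rewrite leq_mul2r cardsD; apply/orP; right; apply: leq_sub2l.
  apply: leq_trans (subset_leq_card (subsetIr _ _)) _.
  by rewrite /E cards2; case: eqP.
apply: leq_trans (_ : \sum_(r in R :\: E) #|X| * energy X r <= _)%N.
  rewrite -sum_nat_const; apply: leq_sum => r; rewrite !inE negb_or => /andP[/andP[r1 rN1]].
  by case/imset2P=> a b aS bS er; rewrite er in r1 rN1 *; apply: energy_ratio.
rewrite -big_distrr /= leq_mul2l; apply/orP; right; apply: leq_trans (sum_energy X).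
by rewrite [X in (_ <= X)%N](bigID (mem (R :\: E))) /= leq_addr.
Qed.

End Energy.

Section Units.
Variable F : finFieldType.
Local Open Scope ring_scope.

Lemma units_abelian : abelian [set: {unit F}].
Proof. by apply/centsP=> x _ y _; apply: val_inj; rewrite /= mulrC. Qed.

(** Pluennecke in the multiplicative group for the pair S^-1, S with exponents 2 and 0. *)
Lemma card_prod_leq_ratio (S : {set F}) : 0 \notin S ->
  (#|[set (a * b)%R | a in S, b in S]| * #|S| <= #|[set (a / b)%R | a in S, b in S]| ^ 2)%N.
Proof.
move=> S0; have [->|/set0Pn[s sS]] := eqVneq S set0; first by rewrite cards0 muln0.
pose V : {set {unit F}} := [set u | val u \in S].
have lift a : a \in S -> exists2 u, u \in V & val u = a.
  move=> aS; have ua : a \is a GRing.unit by rewrite unitfE; apply: contraNneq S0 => <-.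
  by exists (FinRing.unit F ua); rewrite ?inE.
have cardV : #|V| = #|S|.
  rewrite -(card_imset _ val_inj); apply: eq_card => a; apply/imsetP/idP.
    by case=> u; rewrite inE => uS ->.
  by case/lift=> u uV <-; exists u.
have V0 : V != set0 by have [u uV _] := lift s sS; apply/set0Pn; exists u.
have VV0 : (V^-1)%g != set0 by have /set0Pn[u uV] := V0; apply/set0Pn; exists (u^-1)%g; rewrite memV_invg.
have := pluennecke units_abelian 2 0 VV0 V0.
rewrite expg0 invg1 mulg1 expgS expg1 card_invg.
have -> : #|(V * V)%g| = #|[set (a * b)%R | a in S, b in S]|.
  rewrite -(card_imset _ val_inj); apply: eq_card => a; apply/imsetP/imset2P.
    by case=> w /mulsgP[u v]; rewrite !inE => uS vS -> ->; exists (val u) (val v).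
  case=> x y /lift[u uV <-] /lift[v vV <-] ->; exists (u * v)%g => //; exact: mem_mulg.
have -> : #|(V^-1 * V)%g| = #|[set (a / b)%R | a in S, b in S]|.
  rewrite -(card_imset _ val_inj); apply: eq_card => a; apply/imsetP/imset2P.
    case=> w /mulsgP[u v]; rewrite !inE => uS vS -> ->; exists (val v) (val (u^-1)%g) => //.

    by rewrite /= invrK mulrC.
  case=> x y /lift[u uV <-] /lift[v vV <-] ->; exists (v^-1 * u)%g; last by rewrite /= mulrC.
  by rewrite mem_mulg // memV_invg.
rewrite addn0 cardV => hP.
have S_gt0 : (0 < #|S|)%N by rewrite -cardV card_gt0.
by rewrite -(leq_pmul2r S_gt0) -mulnA mulnn.
Qed.

End Units.

(** * Orbits with few coordinates *)

(* A = 2^13 k^10 bounds |T - T| / |T|, so that |6T - 6T| <= A^12 |T|; this bounds |T|,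
   hence h, by O(A^12), and p <= 2 (k h)^2. *)
Definition final_bound k := 128 * k ^ 2 * (8 * 1024 * (k ^ 5 * k ^ 5)) ^ 24.

(** Here N = |X|, u = |U| and L = |S / S|. As p N^2 <= 2 N^4, one gets (L - 2) (m h)^2 <= 12 N^5 <=
    12 (k m)^5, hence L - 2 <= 12 k^5 m^3 / h^2 <= 12 k^5 h. *)
Lemma ratio_bound (L u N m h k p : nat) : 0 < k -> 0 < m -> p <= 2 * N ^ 2 -> N <= k * m ->
  m <= h -> m * h <= 2 * u -> (L - 2) * u ^ 2 <= N * (N ^ 4 + p * N ^ 2) -> L <= 14 * (k ^ 5 * h).
Proof.
move=> k0 m0 pN Nm mh mu; move eM: (L - 2) => M hM.
suff : M <= 12 * (k ^ 5 * h).
  have : 0 < k ^ 5 * h by rewrite muln_gt0 expn_gt0 k0 (leq_trans m0).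
  by move: (k ^ 5 * h) => z; lia.
have h1 : M * (m * h) ^ 2 <= 4 * (N * (N ^ 4 + p * N ^ 2)).
  apply: leq_trans (_ : M * (2 * u) ^ 2 <= _); first by rewrite leq_mul2l leq_exp2r // mu orbT.
  by rewrite expnMn mulnCA leq_mul2l hM.
have h2 : 4 * (N * (N ^ 4 + p * N ^ 2)) <= 12 * N ^ 5.
  have : p * N ^ 2 <= 2 * N ^ 2 * N ^ 2 by rewrite leq_mul2r pN orbT.
  rewrite -mulnA -expnD (expnS N 4); move: (N ^ 4) (p * N ^ 2) => a b; nia.
have h3 : N ^ 5 <= k ^ 5 * m ^ 5 by rewrite -expnMn leq_exp2r.
have mm : 0 < m * m by rewrite muln_gt0 m0.
have hh : 0 < h * h by rewrite muln_gt0 (leq_trans m0 mh).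
have h4 : M * (h * h) <= 12 * (k ^ 5 * (m * (m * m))).
  rewrite -(leq_pmul2r mm); apply: leq_trans (_ : 12 * (k ^ 5 * m ^ 5) <= _).
    apply: leq_trans (leq_trans h2 _); last by rewrite leq_mul2l h3.
    by apply: leq_trans h1; rewrite -mulnn; lia.
  by rewrite !expnS expn0 muln1; move: (k ^ 5) => z; lia.
rewrite -(leq_pmul2r hh); apply: leq_trans h4 _.
have : m * (m * m) <= h * (h * h) by rewrite !leq_mul.
by move: (k ^ 5) => z; nia.
Qed.

(** Here D = |T - T|, P = |S S|, s = |S|, t = |T| and c = k^5: as s >= h / 8, P <= L^2 / s is O(c^2
    h), and h <= 4 t. *)
Lemma difference_bound (D P s L t h c : nat) : 0 < c -> D <= 1 + P -> P * s <= L ^ 2 ->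
  h <= 4 * s.+1 -> 8 <= h -> L <= 14 * (c * h) -> h <= 4 * t -> D <= 8 * 1024 * (c * c) * t.
Proof.
move=> c0 hD Ps hs h8 hL ht.
have h0 : 0 < h by lia.
have hs8 : h <= 8 * s by lia.
have h1 : P * h <= 8 * (L * L).
  apply: leq_trans (_ : P * (8 * s) <= _); first by rewrite leq_mul2l hs8 orbT.
  by rewrite mulnCA leq_mul2l mulnn Ps.
have h2 : P <= 1568 * (c * c * h).
  rewrite -(leq_pmul2r h0); apply: leq_trans h1 _.
  apply: leq_trans (_ : 8 * (14 * (c * h) * (14 * (c * h))) <= _); first by rewrite leq_mul2l leq_mul.
  by lia.
have cc : 0 < c * c by rewrite muln_gt0 c0.
have h3 : c * c * h <= 4 * (c * c * t) by rewrite mulnCA leq_mul2l ht orbT.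
have h4 : 0 < c * c * h by rewrite muln_gt0 cc.
by move: (c * c * h) (c * c * t) (mulnA (8 * 1024) (c * c) t) h2 h3 h4 => x y <-; lia.
Qed.

(** Here E = |6T - 6T|. Pluennecke gives E <= A^12 t, so pivoting yields p t <= A^12 (t^2 + p). If
    t^2 <= p, then t <= 2 A^12, which bounds h and p; otherwise p <= 2 A^12 h, and the incidence
    bound h^2 <= 16 k p concludes. *)
Lemma growth_bound (p h t E A D k : nat) : 0 < A -> 0 < p -> 0 < t ->
  E * t ^ (6 + 6) <= D ^ (6 + 6) * t -> D <= A * t -> p * t ^ 2 <= E * (t ^ 2 + p) ->
  h <= 4 * t -> t <= h -> p <= 2 * (k * h) ^ 2 -> h ^ 2 <= 16 * (k * p) ->
  p <= 128 * k ^ 2 * A ^ 24.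
Proof.
move=> A_gt0 p_gt0 t_gt0 hP hD hpiv ht th p_h hU.
have hE : E <= A ^ 12 * t.
  have t12 : 0 < t ^ 12 by rewrite expn_gt0 t_gt0.
  rewrite -(leq_pmul2r t12); apply: leq_trans hP _.
  apply: leq_trans (_ : (A * t) ^ 12 * t <= _); first by rewrite leq_mul2r leq_exp2r // hD orbT.
  by rewrite expnMn -!mulnA [t * _]mulnC.
have hpt : p * t <= A ^ 12 * (t ^ 2 + p).
  rewrite -(leq_pmul2r t_gt0) -mulnA mulnn; apply: leq_trans hpiv _.
  by rewrite mulnAC leq_mul2r hE orbT.
rewrite (expnD A 12 12); move: (A ^ 12) hpt => B hpt {hP hD hpiv hE A A_gt0 E D}.
have [tp|tp] := leqP (t ^ 2) p.
  have htB : t <= 2 * B.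
    rewrite -(leq_pmul2l p_gt0); apply: leq_trans hpt _.
    apply: leq_trans (_ : B * (2 * p) <= _); last by lia.
    by rewrite leq_mul2l mul2n -addnn leq_add2r tp orbT.
  have hB : h ^ 2 <= (8 * B) ^ 2 by rewrite leq_exp2r //; lia.
  apply: leq_trans p_h _; rewrite expnMn.
  apply: leq_trans (_ : 2 * (k ^ 2 * (8 * B) ^ 2) <= _); first by rewrite !leq_mul2l hB !orbT.
  by rewrite expnMn -mulnn; lia.
have hpB : p <= 2 * B * h.
  apply: leq_trans (_ : 2 * B * t <= _); last by rewrite leq_mul2l th orbT.
  rewrite -(leq_pmul2r t_gt0); apply: leq_trans hpt _.
  apply: leq_trans (_ : B * (2 * t ^ 2) <= _); last by rewrite -mulnn; lia.
  by rewrite leq_mul2l mul2n -addnn leq_add2l ltnW ?orbT.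
have hpp : p ^ 2 <= (2 * B) ^ 2 * (16 * (k * p)).
  apply: leq_trans (_ : (2 * B * h) ^ 2 <= _); first by rewrite leq_exp2r.
  by rewrite expnMn leq_mul2l hU orbT.
rewrite -(leq_pmul2l p_gt0) mulnn; apply: leq_trans hpp _.
have [->|k_gt0] := posnP k; first by rewrite !mul0n !muln0.
have hk : k <= k ^ 2 by rewrite -mulnn leq_pmulr.
rewrite expnMn; apply: leq_trans (_ : 64 * k ^ 2 * (B ^ 2 * p) <= _); last first.
  by rewrite mulnn [p * _]mulnC -!mulnA leq_mul2r orbT.
apply: leq_trans (_ : 64 * k * (B ^ 2 * p) <= _); first lia.
by rewrite leq_mul2r leq_mul2l hk !orbT.
Qed.

Section SmallCase.
Variables (p : nat) (K : fieldType) (iota : {rmorphism 'F_p -> K}).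
Local Open Scope ring_scope.
Variables (h : nat) (zeta : K) (x0 : 'F_p).
Hypothesis p_pr : prime p.
Hypothesis zeta_prim : h.-primitive_root zeta.
Hypothesis zeta_sqr : zeta ^+ 2 != 1.
Hypothesis x0E : iota x0 = zeta + zeta^-1.
Variables (X : {set 'F_p}) (U : {set 'F_p * 'F_p}).
Hypothesis U_ell : forall u n, u \in U -> ell x0 u n \in X.

Let S := sin_set h x0.
Let T := cos_set h x0.

Lemma card_cos_diff : (#|(T^-1 * T)%g| <= 1 + #|[set (a * b)%R | a in S, b in S]|)%N.
Proof.
pose f (r : 'F_p) := (x0 ^+ 2 - 4) * r.
set SS := [set _ | _ in _, _ in _].
pose Z := 0 |: f @: SS.
apply: leq_trans (_ : #|Z| <= _)%N; last first.
  by apply: leq_trans (leq_card_setU _ _) _; rewrite cards1 leq_add2l leq_imset_card.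
apply/subset_leq_card/subsetP=> y /mulsgP[a b]; rewrite inE => aT bT -> {y}.
have -> : (a * b)%g = b - (a^-1)%g.
  by rewrite addrC opprK.
have [->|ne] := eqVneq b (a^-1)%g; first by rewrite subrr /Z !inE eqxx.
have [c [d [cS dS ->]]] := cos_set_diff zeta_prim zeta_sqr x0E bT aT ne.
by rewrite /Z inE; apply/orP; right; apply: imset_f; apply/imset2P; exists c d.
Qed.

(** For i < ceil(h / 2) one has 2i < h, so the powers zeta^(2i) are distinct. *)
Lemma line_family_inj (i j : 'I_(uphalf h)) : i != j ->
  injective (fun u => (ell x0 u i, ell x0 u j)).
Proof.
move=> ij; have hk n : (n < uphalf h -> 2 * n < h)%N.
  by rewrite uphalf_half; have := odd_double_half h; lia.
apply: (ell_inj zeta_prim zeta_sqr x0E).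
rewrite (eq_prim_root_expr zeta_prim) !modn_small.
- by rewrite eqn_pmul2l.
- exact: hk (ltn_ord j).
- exact: hk (ltn_ord i).
Qed.

(** With at most p / 2 coordinates the incidence bound limits h, and the chain from ratios of sines
    to differences of cosines and to the pivot then limits p. *)
Lemma few_coords_bound (m k : nat) :
  (p <= 2 * #|X| ^ 2)%N -> (#|X| <= k * m)%N -> (m <= h)%N -> (m * h <= 2 * #|U|)%N ->
  (2 * #|X| <= p)%N -> (p <= final_bound k)%N.
Proof.
move=> pN Nm mh muU Np.
have cardF : #|'F_p| = p := card_Fp p_pr.
have p_gt0 := prime_gt0 p_pr.
have k_gt0 : (0 < k)%N by case: k Nm pN => // ; case: #|X| => //; lia.
rewrite /final_bound; have k5_gt0 : (0 < k ^ 5)%N by rewrite expn_gt0 k_gt0.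
have [A [A_gt0 leA ->]] : exists A : nat, [/\ 0 < A,
    forall D t, D <= 8 * 1024 * (k ^ 5 * k ^ 5) * t -> D <= A * t &
    8 * 1024 * (k ^ 5 * k ^ 5) = A]%N.
  by exists (8 * 1024 * (k ^ 5 * k ^ 5))%N; split=> //; rewrite (muln_gt0 (8 * 1024)) (muln_gt0 (k ^ 5)) k5_gt0.
have Nh : (#|X| <= k * h)%N by apply: leq_trans Nm _; rewrite leq_mul2l mh orbT.
have p_h : (p <= 2 * (k * h) ^ 2)%N by apply: leq_trans pN _; rewrite leq_mul2l leq_exp2r.
have A24 : (0 < A ^ 24)%N by rewrite expn_gt0 A_gt0.
have [h8|h8] := ltnP h 8.
  apply: leq_trans p_h _; apply: leq_trans (_ : 128 * k ^ 2 <= _)%N; last exact: leq_pmulr.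
  have : (h ^ 2 <= 64)%N by rewrite -mulnn; nia.
  by rewrite expnMn; nia.
have m_gt0 : (0 < m)%N by case: m Nm {mh muU} => //; case: #|X| pN => //; lia.
have hU : (h ^ 2 <= 16 * (k * p))%N.
  have I_gt1 : (1 < #|'I_(uphalf h)|)%N by rewrite card_ord uphalf_half; have := odd_double_half h; lia.
  have cardFF : #|{: 'F_p * 'F_p}| = (#|'F_p| ^ 2)%N by rewrite card_prod mulnn.
  have := @orthogonal_covered _ _ _ (fun i u => ell x0 u (nat_of_ord i)) cardFF I_gt1 line_family_inj X U.
  rewrite cardF => /(_ (fun w i wU => U_ell i wU) Np); rewrite card_ord.
  have : (h <= 2 * uphalf h)%N by rewrite uphalf_half; have := odd_double_half h; lia.
  move: (uphalf h) => d hd hUd.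
  have h1 : (m * h * h <= 16 * (p * #|X|))%N.
    apply: leq_trans (leq_mul muU hd) _; rewrite mulnACA.
    by move: (#|U| * d)%N (p * #|X|)%N hUd => a b; lia.
  have h2 : (m * h * h <= 16 * (p * (k * m)))%N.
    by apply: leq_trans h1 _; rewrite !leq_mul2l Nm !orbT.
  by rewrite -(leq_pmul2l m_gt0) -mulnn; lia.
have leL := card_sin_ratio zeta_prim zeta_sqr x0E U_ell.
have S0 : 0 \notin S by rewrite !inE eqxx.
have leSS := card_prod_leq_ratio S0.
have leTT := card_cos_diff.
have hT := leq_card_cos_set zeta_prim zeta_sqr x0E; have hS := leq_card_sin_set zeta_prim zeta_sqr x0E.
have Th : (#|T| <= h)%N by apply: leq_trans (leq_imset_card _ _) _; rewrite card_ord.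
rewrite -/S in leL hS; rewrite -/T in hT.
move: leL leSS leTT; set L := #|[set _ | _ in _, _ in _]|; set SS := #|[set _ | _ in _, _ in _]|.
rewrite cardF => leL leSS leTT.
set D := #|(T^-1 * T)%g| in leTT.
have hL : (L <= 14 * (k ^ 5 * h))%N := ratio_bound k_gt0 m_gt0 pN Nm mh muU leL.
have hD : (D <= A * #|T|)%N := leA _ _ (difference_bound k5_gt0 leTT leSS hS h8 hL hT).
have T_gt1 : (1 < #|T|)%N.
  by rewrite -(leq_pmul2l (isT : 0 < 4)%N); apply: leq_trans hT.
have T0 : T != set0 by rewrite -card_gt0 ltnW.
have TV0 : (T^-1)%g != set0 by rewrite -card_gt0 card_invg ltnW.
have Fab : abelian [set: 'F_p].
  by apply/centsP=> x _ y _; apply: addrC.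
have := pluennecke Fab 6 6 TV0 T0; rewrite card_invg -/D => hP.
have hpiv := pivot p_pr T_gt1 (cos_setM zeta_prim zeta_sqr x0E).
exact: (growth_bound A_gt0 p_gt0 (ltnW T_gt1) hP hD hpiv hT Th p_h hU).
Qed.
End SmallCase.

(** * Orbits with many coordinates *)

Lemma add_inv_inj (K : fieldType) (a b : K) : (a != 0 -> b != 0 ->
  a + a^-1 = b + b^-1 -> a = b \/ a = b^-1)%R.
Proof.
move=> a0 b0 e; have : ((a - b) * (a - b^-1) == 0)%R.
  apply/eqP; transitivity (a * (a + a^-1 - (b + b^-1)) - (a * a^-1 - b * b^-1))%R; first by ring.
  by rewrite e !divff // !subrr mulr0 subrr.
by rewrite mulf_eq0 !subr_eq0 => /orP[/eqP|/eqP]; [left | right].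
Qed.

Section Torus.
Variables (p : nat) (p_pr : prime p).
Local Open Scope ring_scope.

(** w is a root of t^2 - x t + 1. Frobenius fixes x, so w^p is w or 1 / w, and the order of w
    divides p - 1 or p + 1 accordingly. *)
Lemma exists_eigenvalue (K : closedFieldType) (iota : {rmorphism 'F_p -> K}) (x : 'F_p) :
  exists w : K, [/\ w != 0, iota x = w + w^-1 &
    exists2 h, h.-primitive_root w & (h \in divisors p.-1) || (h \in divisors p.+1)].
Proof.
have [w ew] := @solve_monicpoly K 2 (fun i => if i == 0%N then -1 else iota x) isT.
move: ew; rewrite !big_ord_recl big_ord0 /= expr0 mulr1 expr1 addr0 => ew.
have w0 : w != 0.
  by apply: contra_eqN ew => /eqP ->; rewrite expr0n mulr0 addr0 eq_sym oppr_eq0 oner_eq0.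
have ex : iota x = w + w^-1.
  apply: (mulIf w0); rewrite mulrDl mulVf // -expr2 ew; ring.
exists w; split=> //.
have chK : p \in [pchar K] := rmorph_pchar iota (pchar_Fp p_pr).
have eF : w ^+ p + (w ^+ p)^-1 = w + w^-1.
  rewrite -exprVn -!(pFrobenius_autE chK) -pFrobenius_autD_comm; last exact: mulrC.
  rewrite -ex pFrobenius_autE -rmorphXn; congr (iota _).
  by have := expf_card x; rewrite card_Fp.
have p_gt0 := prime_gt0 p_pr.
have wn n : w ^+ n = 1 -> (0 < n)%N -> exists2 h, h.-primitive_root w & h \in divisors n.
  by move=> e n0; have [h hP hn] := prim_order_exists n0 e; exists h; rewrite -?dvdn_divisors.
have [e|e] := add_inv_inj (expf_neq0 p w0) w0 eF.
  have [||h hP hd] := wn p.-1; last by exists h; rewrite ?hd.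
    by apply: (mulIf w0); rewrite mul1r -exprSr prednK.
  by have := prime_gt1 p_pr; case: p => [|[]].
have [||h hP hd] := wn p.+1 => //; last by exists h; rewrite ?hd ?orbT.
by rewrite exprSr e mulVf.
Qed.

Lemma exists_generator : exists g : 'F_p, p.-1.-primitive_root g.
Proof.
have p1 : (0 < p.-1)%N by have := prime_gt1 p_pr; case: p => [|[]].
have := @has_prim_root _ p.-1 (enum [pred x : 'F_p | x != 0]) p1.
case/(_ _ _ _)/hasP.
- apply/allP=> x; rewrite mem_enum inE => x0; apply/unity_rootP.
  apply: (mulIf x0); rewrite mul1r -exprSr prednK ?prime_gt0 //.
  by have := expf_card x; rewrite card_Fp.
- exact: enum_uniq.
- by rewrite -cardE cardC1 card_Fp.
by move=> g _ gP; exists g.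
Qed.

(** The trace w + 1 / w is at most two-to-one on primitive roots. *)
Lemma card_torus_traces (g : 'F_p) : p.-1.-primitive_root g ->
  (totient p.-1 <= 2 * #|[set (g ^+ i + (g ^+ i)^-1)%R | i : 'I_p.-1 in [set j : 'I_p.-1 | coprime j p.-1]]|)%N.
Proof.
move=> gP; set A := [set j | _]; set M := [set _ | _ in _]; pose f (i : 'I_p.-1) := g ^+ i + (g ^+ i)^-1.
have g0 : g != 0 := prim_root_neq0 gP.
have -> : totient p.-1 = #|A|.
  rewrite totient_count_coprime big_mkord -sum1_card [RHS]big_mkcond /=.
  by apply: eq_bigr => i _; rewrite inE coprime_sym; case: coprime.
have -> : A = [set i in A | f i \in M].
  by apply/setP=> i; rewrite [RHS]in_set; symmetry; apply: andb_idr => iA; apply: imset_f.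
rewrite card_fibers mulnC -sum_nat_const; apply: leq_sum => y /imsetP[j jA ->].
apply: leq_trans (_ : #|[set g ^+ j; (g ^+ j)^-1]| <= _)%N; last by rewrite cards2; case: eqP.
rewrite -[X in (X <= _)%N](card_in_imset (f := fun i : 'I_p.-1 => g ^+ i)).
  apply/subset_leq_card/subsetP=> z /imsetP[i]; rewrite inE => /andP[_ /eqP e] -> {z}.
  by rewrite !inE; case: (add_inv_inj _ _ e) => [||->|->]; rewrite ?expf_neq0 ?eqxx ?orbT.
move=> i k _ _ /eqP; rewrite (eq_prim_root_expr gP) !modn_small // => /eqP; exact: val_inj.
Qed.

(* On a conic with fixed first coordinate w + 1/w, the eigen-coordinate z - y/w
   is multiplied by w under rotation, and it determines the point. *)
Lemma conic_transitive (w : 'F_p) (P Q : 'F_p * 'F_p * 'F_p) :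
  p.-1.-primitive_root w -> w ^+ 4 != 1 -> P \in markoff_points _ -> Q \in markoff_points _ ->
  P.1.1 = w + w^-1 -> Q.1.1 = w + w^-1 -> exists n, iter n (@rotation _) P = Q.
Proof.
move=> wP w4; rewrite !inE /on_markoff => /andP[/eqP eP _] /andP[/eqP eQ _] xP xQ.
have w0 : w != 0 := prim_root_neq0 wP.
have w2 : w ^+ 2 != 1 by apply: contra_neq w4; rewrite (exprM w 2 2) => ->; rewrite expr1n.
have nwV : w - w^-1 != 0.
  by rewrite subr_eq0; apply: contra_neq w2 => e; rewrite expr2 {2}e divff.
have x0 : w + w^-1 != 0.
  apply: contra_neq w4 => e; have : w ^+ 2 = -1.
    by apply/eqP; rewrite -addr_eq0; apply/eqP; transitivity (w * (w + w^-1) + (1 - w * w^-1));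
      [ring | rewrite e divff // subrr mulr0 addr0].
  by rewrite (exprM w 2 2) => ->; rewrite sqrrN expr1n.
pose s (R : 'F_p * 'F_p * 'F_p) := R.2 - w^-1 * R.1.2.
pose t (R : 'F_p * 'F_p * 'F_p) := R.2 - w * R.1.2.
(* On the conic s t is a nonzero constant, so the eigen-coordinate s determines t, hence y and z. *)
have st R : R.1.1 = w + w^-1 -> R.1.1 ^+ 2 + R.1.2 ^+ 2 + R.2 ^+ 2 = R.1.1 * R.1.2 * R.2 ->
    s R * t R = - (w + w^-1) ^+ 2.
  move=> -> e; apply/eqP; rewrite -addr_eq0; apply/eqP.
  transitivity ((w + w^-1) ^+ 2 + R.1.2 ^+ 2 + R.2 ^+ 2 - (w + w^-1) * R.1.2 * R.2
     + (w * w^-1 - 1) * R.1.2 ^+ 2); first by rewrite /s /t; ring.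
  by rewrite e divff // !subrr mul0r addr0.
have sP0 : s P != 0.
  apply/eqP=> s0; have := st P xP eP; rewrite s0 mul0r => /esym/eqP.
  by rewrite oppr_eq0 sqrf_eq0 (negbTE x0).
have sQ0 : s Q != 0.
  apply/eqP=> s0; have := st Q xQ eQ; rewrite s0 mul0r => /esym/eqP.
  by rewrite oppr_eq0 sqrf_eq0 (negbTE x0).
have [n en] : {n : 'I_p.-1 | s Q / s P = w ^+ n}.
  apply: (prim_rootP wP); apply: (mulIf (mulf_neq0 sQ0 (invr_neq0 sP0))).
  rewrite mul1r -exprSr prednK ?prime_gt0 //.
  by have := expf_card (s Q / s P); rewrite card_Fp.
exists n; set R := iter n _ P.
have [xR eR] : R.1.1 = w + w^-1 /\ R.1.1 ^+ 2 + R.1.2 ^+ 2 + R.2 ^+ 2 = R.1.1 * R.1.2 * R.2.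
  rewrite /R; elim: (n : nat) => [|m [IHx IHe]] //=; split=> //.
  by rewrite /rotation /=; move: IHe; set V := iter m _ P => IHe; apply/eqP; rewrite -subr_eq0;
     move/eqP: IHe; rewrite -subr_eq0 => /eqP <-; apply/eqP; ring.
have sR : s R = s Q.
  have -> : s R = w ^+ n * s P; last by rewrite -en mulfVK.
  suff H m : (iter m (@rotation _) P).1.1 = w + w^-1 /\ s (iter m (@rotation _) P) = w ^+ m * s P by have [] := H n.
  elim: m => [|m [IHx IHs]]; first by rewrite expr0 mul1r.
  rewrite iterS; split=> //; rewrite exprS -mulrA -IHs /s /rotation /= IHx.
  transitivity (w * (iter m (@rotation _) P).2 - (w * w^-1) * (iter m (@rotation _) P).1.2); last by ring.
  by rewrite divff // mul1r; ring.
have tR : t R = t Q.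
  by apply: (mulfI sQ0); rewrite (st Q xQ eQ) -sR (st R xR eR).
have eY : R.1.2 = Q.1.2.
  apply: (mulfI nwV); transitivity (s R - t R); first by rewrite /s /t; ring.
  by rewrite sR tR /s /t; ring.
have eZ : R.2 = Q.2 by move: sR; rewrite /s eY => /addIr.
have eX : R.1.1 = Q.1.1 by rewrite xR xQ.
by move: eX eY eZ; clear; case: R Q => [[? ?] ?] [[? ?] ?] /= -> -> ->.
Qed.

End Torus.

Lemma leq_sum_max (T : eqType) (s : seq T) (c : T -> nat) : s != [::] ->
  exists2 r, r \in s & \sum_(x <- s) c x <= size s * c r.
Proof.
elim: s => // a [|b s] IH _; first by exists a; rewrite ?mem_head // big_seq1 mul1n.
have [//|r rs le] := IH; rewrite /= in le; rewrite big_cons [size (a :: _)]/=.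
have [ra|ar] := leqP (c r) (c a).
  exists a; rewrite ?mem_head // mulSn leq_add2l (leq_trans le) // leq_mul2l.
  by rewrite ra orbT.
exists r; first by rewrite inE rs orbT.
by rewrite mulSn leq_add // ltnW.
Qed.

Lemma pigeonhole_seq (aT : finType) (rT : eqType) (A : {set aT}) (f : aT -> rT) (s : seq rT) :
  A != set0 -> (forall x, x \in A -> f x \in s) ->
  exists2 r, r \in s & #|A| <= size s * #|[set x in A | f x == r]|.
Proof.
move=> /set0Pn[x0 x0A] fs; have s0 : s != [::] by apply: contraTneq (fs _ x0A) => ->.
have [r rs le] := leq_sum_max (fun r => #|[set x in A | f x == r]|) s0.
exists r; rewrite // (leq_trans _ le) // => {le}.
under eq_bigr => y _ do rewrite -sum1dep_card.
rewrite -sum1_card (exchange_big_dep (mem A)) /=; last by move=> y x _ /andP[].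
apply: leq_sum => x xA; rewrite (big_rem (f x)) ?fs //=.
by rewrite xA eqxx.
Qed.

(** B counts the missed coordinates, u = |U|, and d counts directions. As p is at most 2 k m and 2 k
    h, p^3 <= 8 k^3 m h^2 <= 32 k^3 u d. *)
Lemma missing_bound (p N k m h u d B : nat) : 0 < p -> p <= 2 * N -> N <= k * m -> m <= h ->
  m * h <= 2 * u -> h <= 2 * d -> u * (d * B) <= p ^ 3 -> B <= 32 * k ^ 3.
Proof.
move=> p0 pN Nm mh mu hd hB.
have pm : p <= 2 * k * m by apply: leq_trans pN _; rewrite -mulnA leq_mul2l Nm.
have ph : p <= 2 * k * h by apply: leq_trans pm _; rewrite leq_mul2l mh orbT.
have p3 : p ^ 3 <= 8 * k ^ 3 * (m * h * h).
  apply: leq_trans (_ : 2 * k * m * (2 * k * h * (2 * k * h)) <= _); first by rewrite !expnS expn0 muln1 !leq_mul.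
  by rewrite !expnS expn0 muln1; lia.
have p30 : 0 < p ^ 3 by rewrite expn_gt0 p0.
rewrite -(leq_pmul2l p30); apply: leq_trans (leq_mul p3 (leqnn B)) _.
apply: leq_trans (_ : 8 * k ^ 3 * (2 * u * (2 * d) * B) <= _).
  by rewrite -[_ * B]mulnA leq_mul2l; apply/orP; right; rewrite leq_mul2r leq_mul ?orbT.
apply: leq_trans (_ : 8 * k ^ 3 * (4 * p ^ 3) <= _); last by lia.
rewrite leq_mul2l; apply/orP; right.
by rewrite mulnACA -mulnA -[_ * d * _]mulnA leq_mul2l hB orbT.
Qed.

(** * Structure of the coordinates of a stable set *)

Section Structure.
Variables (p : nat) (p_pr : prime p).
Local Open Scope ring_scope.

(** The factor 2 pays for discarding the coordinates 2 and -2. *)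
Definition order_bound n := (2 * (ndiv n.-1 + ndiv n.+1))%N.

Variable O : {set 'F_p * 'F_p * 'F_p}.
Hypothesis p_gt : (32 < p)%N.
Hypothesis O_stable : stable O.
Hypothesis O_sub : O \subset markoff_points 'F_p.
Hypothesis O_neq0 : O != set0.

(** p divides |O| by [card_stable], so p <= |O|; over each pair (x, y) lie at most two points, z
    being a root of a quadratic. *)
Lemma leq_card_coords : (p <= 2 * #|coords O| ^ 2)%N.
Proof.
have pO : (p <= #|O|)%N.
  apply: dvdn_leq; first by rewrite card_gt0.
  by rewrite (dvdn_pcharf (pchar_Fp p_pr)) card_stable.
apply: leq_trans pO _; pose f (P : 'F_p * 'F_p * 'F_p) := P.1.
have eO : O = [set P in O | f P \in setX (coords O) (coords O)].
  apply/setP=> P; rewrite [RHS]in_set; symmetry; apply: andb_idr => PO.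
  by rewrite inE coords2 // andbT; apply: imset_f.
rewrite {1}eO card_fibers -mulnn -cardsX mulnC -sum_nat_const; apply: leq_sum => xy _.
have [->|/set0Pn[P]] := eqVneq [set P in O | f P == xy] set0; first by rewrite cards0.
rewrite inE => /andP[PO /eqP fP].
pose E := [set P.2; xy.1 * xy.2 - P.2].
apply: leq_trans (_ : #|E| <= _)%N; last by rewrite /E cards2; case: eqP.
rewrite -[X in (X <= _)%N](card_in_imset (f := snd)); last first.
  by move=> [Q z] [R t]; rewrite !inE => /andP[_ /eqP /= ->] /andP[_ /eqP /= ->] ->.
apply/subset_leq_card/subsetP=> z /imsetP[Q]; rewrite inE => /andP[QO /eqP fQ] -> {z}.
have /(subsetP O_sub) := PO; have /(subsetP O_sub) := QO.
rewrite !inE /on_markoff -!/(f _) fP fQ => /andP[/eqP eQ _] /andP[/eqP eP _].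
have : (Q.2 - P.2) * (Q.2 - (xy.1 * xy.2 - P.2)) == 0.
  apply/eqP; transitivity ((xy.1 ^+ 2 + xy.2 ^+ 2 + Q.2 ^+ 2 - xy.1 * xy.2 * Q.2) -
    (xy.1 ^+ 2 + xy.2 ^+ 2 + P.2 ^+ 2 - xy.1 * xy.2 * P.2)); first by ring.
  by rewrite eQ eP !subrr.
by rewrite mulf_eq0 !(subr_eq0 Q.2).
Qed.

(** h is the most frequent eigenvalue order among the coordinates other than 2 and -2, m the number
    of coordinates of that order, x0 one of them, and U the glued plane set. *)
Lemma coords_structure :
  exists (K : fieldType) (iota : {rmorphism 'F_p -> K}) (h : nat) (zeta : K) (x0 : 'F_p)
    (U : {set 'F_p * 'F_p}) (m : nat),
  [/\ h.-primitive_root zeta, zeta ^+ 2 != 1, iota x0 = zeta + zeta^-1,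
    forall u n, u \in U -> ell x0 u n \in coords O &
    [/\ #|coords O| <= order_bound p * m, m <= h & m * h <= 2 * #|U|]%N].
Proof.
have [K [iota _]] := countable_algebraic_closure 'F_p.
have [wf wfP] := fin_all_exists (exists_eigenvalue p_pr iota).
have hfE x : exists h, h.-primitive_root (wf x) /\ h \in divisors p.-1 ++ divisors p.+1.
  by have [_ _ [h hP hd]] := wfP x; exists h; rewrite mem_cat.
have [hf hfP] := fin_all_exists hfE.
have leN := leq_card_coords.
set N := #|coords O| in leN *.
have two_neq0 : 2 != 0 :> 'F_p.
  rewrite -(dvdn_pcharf (pchar_Fp p_pr)); apply/negP=> /dvdn_leq.
  by move/(_ isT); rewrite leqNgt (leq_trans _ p_gt).
(* There the two eigenvalues coincide and the rotation is not diagonalizable. *)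
pose E : {set 'F_p} := [set 2; -2].
pose X := coords O :\: E.
have leX : (N <= 2 * #|X|)%N.
  have N4 : (4 <= N)%N by rewrite leqNgt; apply/negP=> N4; have : (N ^ 2 <= 3 ^ 2)%N; [rewrite leq_exp2r | lia].
  have : (N <= #|X| + 2)%N.
    rewrite /X cardsD addnC -leq_subLR; apply: leq_sub2l.
    apply: leq_trans (subset_leq_card (subsetIr _ _)) _.
    by rewrite /E cards2; case: eqP.
  by lia.
have X0 : X != set0.
  by rewrite -card_gt0; move: leN leX; case: #|X| => //; case: N => //; lia.
have [h hs leC] := pigeonhole_seq X0 (fun x _ => proj2 (hfP x)).
set C := [set _ in X | _] in leC.
have C0 : C != set0.
  by rewrite -card_gt0; move: leC X0; rewrite -card_gt0; case: #|C| => //; rewrite muln0; case: #|X|.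
have [x0 x0C] := set0Pn _ C0.
have CP x : x \in C -> [/\ x \in coords O, x != 2, x != -2, h.-primitive_root (wf x) & iota x = wf x + (wf x)^-1].
  rewrite !inE negb_or => /andP[/andP[/andP[n2 nN2] xO] /eqP eh].
  by split=> //; [rewrite -eh; case: (hfP x) | case: (wfP x)].
have [_ n2 nN2 zP x0E] := CP _ x0C; set zeta := wf x0 in zP x0E.
have z0 : zeta != 0 := prim_root_neq0 zP.
have z2 : zeta ^+ 2 != 1.
  rewrite sqrf_eq1 negb_or; apply/andP; split.
    by apply: contra_neq n2 => e; apply: (fmorph_inj iota); rewrite x0E e invr1 rmorph_nat.
  apply: contra_neq nN2 => e; apply: (fmorph_inj iota).
  by rewrite x0E e invrN1 rmorphN rmorph_nat -opprD.
have h0 := prim_order_gt0 zP.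
(* Elements of order h generate the same cyclic subgroup of K, so each is a power of zeta and
   conversely. *)
have ind x : x \in C -> exists u : 'I_h * 'I_h, order_class_index iota zeta x u.
  case/CP=> _ _ _ wP ex.
  have [j ej] := prim_rootP zP (prim_expr_order wP).
  have [e ee] := prim_rootP wP (prim_expr_order zP).
  exists (j, e); rewrite /order_class_index /= ex exprVn -ej eqxx /=.
  by rewrite exprM -ej -ee.
have sC : C \subset order_class iota O h zeta.
  apply/subsetP=> x xC; rewrite inE; have [-> _ _ _ _] := CP _ xC.
  by apply/existsP/ind.
exists K, iota, h, zeta, x0, (plane_set iota O zP), #|C|; split=> //.
  by move=> u n; apply: (ell_plane_coords O_stable z2 x0E).
split.
- apply: leq_trans leX _; rewrite /order_bound -mulnA leq_mul2l /=.
  apply: leq_trans leC _; rewrite leq_mul2r size_cat leq_add ?orbT //.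
    by apply: size_divisors_leq; rewrite -subn1 subn_gt0 prime_gt1.
  exact: size_divisors_leq.
(* The exponent j < h with x = zeta^j + zeta^-j determines x, so m <= h. *)
- have cinj : {in C &, injective (fun x => odflt (Ordinal h0) [pick j : 'I_h | [exists e, order_class_index iota zeta x (j, e)]])}.
    have cl x : x \in C -> iota x = zeta ^+ (odflt (Ordinal h0) [pick j : 'I_h | [exists e, order_class_index iota zeta x (j, e)]]) +
        zeta^-1 ^+ (odflt (Ordinal h0) [pick j : 'I_h | [exists e, order_class_index iota zeta x (j, e)]]).
      move=> /ind[[j e] he]; case: pickP => [k /existsP[e' /andP[/eqP]] //|].
      by move/(_ j)/negbT/existsPn/(_ e); rewrite he.
    by move=> x y xC yC exy; apply: (fmorph_inj iota); rewrite (cl x xC) (cl y yC) exy.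
  by rewrite -(card_in_imset cinj) (leq_trans (max_card _)) ?card_ord.
- apply: leq_trans _ (card_plane_set iota two_neq0 O_stable O_sub zP z2).
  by rewrite leq_mul2r subset_leq_card ?orbT.
Qed.

(** [few_coords_bound] excludes having at most p / 2 coordinates, so m and h are at least p / (2k).
    As no point of U projects to a missed coordinate, [orthogonal_missing] limits their number. *)
Lemma card_coordsC : (final_bound (order_bound p) < p)%N ->
  (#|~: coords O| <= 32 * order_bound p ^ 3)%N.
Proof.
move=> hp; have [K [iota [h [zeta [x0 [U [m [zP z2 x0E Uell [Nm mh mU]]]]]]]]] := coords_structure.
move: Nm hp; set k := order_bound p => Nm hp.
have [Np|Np] := leqP (2 * #|coords O|) p.
  have := few_coords_bound p_pr zP z2 x0E Uell leq_card_coords Nm mh mU Np.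
  by rewrite leqNgt hp.
have cardF : #|'F_p| = p := card_Fp p_pr.
have h_gt2 : (2 < h)%N.
  have := prim_order_gt0 zP; case: (h) zP => [|[|[|]]] // zP _.
    by case/eqP: z2; rewrite -[zeta]expr1 (prim_expr_order zP) expr1n.
  by case/eqP: z2; rewrite (prim_expr_order zP).
have I_gt1 : (1 < #|'I_(uphalf h)|)%N by rewrite card_ord uphalf_half; have := odd_double_half h; lia.
have cardFF : #|{: 'F_p * 'F_p}| = (#|'F_p| ^ 2)%N by rewrite card_prod mulnn.
have := @orthogonal_missing _ _ _ (fun i u => ell x0 u (nat_of_ord i)) cardFF I_gt1
  (line_family_inj p_pr zP z2 x0E) (~: coords O) U.
rewrite cardF card_ord => hmiss.
have {hmiss} hB : (#|U| * (uphalf h * #|~: coords O|) <= p ^ 3)%N.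
  by apply: hmiss => w i wU; rewrite inE negbK Uell.
have hd : (h <= 2 * uphalf h)%N by rewrite uphalf_half; have := odd_double_half h; lia.
have p_gt0 := prime_gt0 p_pr.
exact: (missing_bound p_gt0 (ltnW Np) Nm mh mU hd hB).
Qed.

End Structure.

Lemma leq_final_bound k : 0 < k -> 128 * k ^ 4 < final_bound k.
Proof.
move=> k0; rewrite /final_bound.
have k5 : k <= k ^ 5 by rewrite -[X in X <= _]expn1 leq_pexp2l.
have kk : k ^ 2 <= k ^ 5 * k ^ 5 by rewrite -mulnn leq_mul.
have k2 : 0 < k ^ 2 by rewrite expn_gt0 k0.
rewrite (expnD k 2 2); move: (k ^ 5 * k ^ 5) (k ^ 2) kk k2 => a b ab b0.
have hA : 2 * b <= 8 * 1024 * a by apply: leq_mul.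
have A0 : 0 < 8 * 1024 * a by apply: leq_trans hA; rewrite muln_gt0.
apply: (@leq_trans (128 * b * (2 * b))).
  by rewrite mulnA ltn_pmul2l ?muln_gt0 ?b0 // mul2n -addnn -[X in X < _]addn0 ltn_add2l.
rewrite leq_mul2l; apply/orP; right; apply: leq_trans hA _.
by rewrite -[X in X <= _]expn1 leq_pexp2l.
Qed.

Lemma ndiv_gt0 n : 0 < ndiv n.
Proof. exact: prodn_gt0. Qed.

(** * Intersection of two stable sets *)

Section Meet.
Variables (p : nat) (p_pr : prime p).
Local Open Scope ring_scope.
Hypothesis p_large : (final_bound (order_bound p) < p)%N.

Let k := order_bound p.

Let k_gt0 : (0 < k)%N.
Proof. by rewrite /k /order_bound muln_gt0 addn_gt0 ndiv_gt0. Qed.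

Let p_gt : ((128 * k ^ 4).+1 < p)%N := leq_ltn_trans (leq_final_bound k_gt0) p_large.

Let p_gt32 : (32 < p)%N.
Proof.
apply: leq_ltn_trans p_gt; apply: leqW.
by rewrite -[32%N]/(32 * 1)%N leq_mul // expn_gt0 k_gt0.
Qed.

(** Together the two sets miss at most 64 k^3 coordinates, fewer than the (p - 1) / (2k) or more
    traces of primitive roots. A common trace puts points of both sets on one conic, where the
    rotation is transitive. *)
Lemma stable_meet (O1 O2 : {set 'F_p * 'F_p * 'F_p}) :
  stable O1 -> O1 \subset markoff_points _ -> O1 != set0 ->
  stable O2 -> O2 \subset markoff_points _ -> O2 != set0 ->
  exists P, (P \in O1) && (P \in O2).
Proof.
move=> st1 s1 n1 st2 s2 n2.
have h1 := card_coordsC p_pr p_gt32 st1 s1 n1 p_large.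
have h2 := card_coordsC p_pr p_gt32 st2 s2 n2 p_large.
have [g gP] := exists_generator p_pr.
have hM := card_torus_traces gP; set M := [set _ | _ in _] in hM.
have p1 : (0 < p.-1)%N by rewrite -subn1 subn_gt0 prime_gt1.
have M_large : (64 * k ^ 3 < #|M|)%N.
  rewrite ltnNge; apply/negP=> leM; move: p_gt; rewrite -(prednK (prime_gt0 p_pr)) ltnS ltnNge => /negP[].
  apply: leq_trans (leq_ndiv_totient p1) _.
  apply: leq_trans (_ : k * (2 * (64 * k ^ 3)) <= _)%N; last by rewrite (expnS k 3); lia.
  apply: leq_mul; last by apply: leq_trans hM _; rewrite leq_mul2l.
  by rewrite /k /order_bound mul2n -addnn -!addnA leq_addr.
have [y yM y12] : exists2 y, y \in M & (y \in coords O1) && (y \in coords O2).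
  apply/exists_inP; apply: contraLR M_large => /exists_inPn no; rewrite -leqNgt.
  apply: leq_trans (_ : #|~: coords O1 :|: ~: coords O2| <= _)%N.
    by apply/subset_leq_card/subsetP=> y /no; rewrite !inE negb_and.
  apply: leq_trans (leq_card_setU _ _) _; apply: leq_trans (leq_add h1 h2) _.
  by rewrite -mulnDl.
case/andP: y12 => /imsetP[P PO yP] /imsetP[Q QO yQ].
case/imsetP: yM => j; rewrite inE => cj ey.
have wP : p.-1.-primitive_root (g ^+ j) by rewrite (prim_root_exp_coprime _ gP).
have w4 : (g ^+ j) ^+ 4 != 1.
  rewrite -(prim_order_dvd wP); apply/negP=> /(dvdn_leq (isT : 0 < 4)%N); apply/negP.
  by rewrite -ltnNge -ltnS prednK ?prime_gt0 // (ltn_trans _ p_gt32).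
have [n en] := conic_transitive p_pr wP w4 (subsetP s1 _ PO) (subsetP s2 _ QO) (etrans (esym yP) ey) (etrans (esym yQ) ey).
by exists Q; rewrite QO andbT -en; apply: stable_iter_rot.
Qed.

End Meet.

(** * The explicit bound *)

Lemma final_boundE k : final_bound k = 2 ^ 319 * k ^ 242.
Proof.
rewrite /final_bound -[128]/(2 ^ 7) -[8]/(2 ^ 3) -[1024]/(2 ^ 10) -!expnD expnMn -!expnM.
by rewrite mulnACA -!expnD.
Qed.

(** The divisor bound gives k^q <= 2^(2e) p, so the q-th power of 2^319 k^242 is at most 2^(1024 e)
    p^242 < p^243 <= p^q. *)
Lemma final_bound_lt (q e C p : nat) : 242 < q -> 2 * q < e -> C <= 2 ^ e -> 1 < p ->
  (forall n, 0 < n -> ndiv n ^ q <= C * n) -> 2 ^ (1024 * e) < p ->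
  final_bound (order_bound p) < p.
Proof.
move=> q_gt e_gt C_le p_gt1 ndivC p_gt; set k := order_bound p.
have q0 : 0 < q by apply: leq_trans q_gt.
have kq : k ^ q <= 2 ^ (e + e) * p.
  pose a := ndiv p.-1; pose b := ndiv p.+1.
  have ha : a ^ q <= C * p.+1.
    apply: leq_trans (ndivC _ _) _; first by rewrite -subn1 subn_gt0.
    by rewrite leq_mul2l (leq_trans (leq_pred _)) ?orbT.
  have hb : b ^ q <= C * p.+1 by apply: ndivC.
  have hm : maxn a b ^ q <= C * p.+1 by rewrite /maxn; case: ifP.
  apply: (@leq_trans ((2 ^ 2 * maxn a b) ^ q)).
    rewrite leq_exp2r // /k /order_bound -[2 ^ 2]/(2 * 2) -mulnA leq_mul2l /= mul2n -addnn.
    by rewrite leq_add ?leq_maxl ?leq_maxr.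
  rewrite expnMn -expnM; apply: leq_trans (leq_mul (leqnn _) hm) _.
  apply: (@leq_trans (2 ^ (2 * q) * (2 ^ e * (2 ^ 1 * p)))).
    rewrite leq_mul2l; apply/orP; right; apply: leq_mul => //.
    by rewrite expn1 mul2n -addnn -addn1 leq_add2l ltnW.
  rewrite [2 ^ e * _]mulnA mulnA -!expnD leq_mul2r leq_exp2l //.
  by apply/orP; right; move: e_gt; clear; lia.
rewrite -(ltn_exp2r _ _ q0) final_boundE expnMn -!expnM [242 * q]mulnC [k ^ _]expnM.
have kq242 : (k ^ q) ^ 242 <= (2 ^ (e + e) * p) ^ 242 by rewrite leq_exp2r.
apply: leq_ltn_trans (leq_mul (leqnn _) kq242) _.
rewrite expnMn -expnM mulnA -expnD.
have he : 319 * q + (e + e) * 242 <= 1024 * e.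
  have : q <= e by apply: leq_trans (ltnW e_gt); rewrite leq_pmull.
  by clear; lia.
apply: (@leq_ltn_trans (2 ^ (1024 * e) * p ^ 242)); first by rewrite leq_mul2r leq_exp2l ?he ?orbT.
apply: (@leq_trans (p ^ 243)); first by rewrite (expnS p 242) ltn_pmul2r ?expn_gt0 ?(ltnW p_gt1) //.
by rewrite leq_exp2l.
Qed.

Lemma tower_bound a : 2 ^ (2 ^ (3 * a)) <= 10 ^ (10 ^ a).
Proof.
apply: (@leq_trans (2 ^ (10 ^ a))).
  by rewrite leq_exp2l // expnM; case: a => // a; rewrite leq_exp2r //.
by case: (10 ^ a) => // n; rewrite leq_exp2r //.
Qed.

(* The exponents are variables so that they are never computed. *)
Lemma final_bound_lt_tower (a q r p : nat) : q = 2 ^ r -> 242 < q -> r + r + q + 10 <= 3 * a ->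
  10 ^ (10 ^ a) < p -> final_bound (order_bound p) < p.
Proof.
move=> qr q_gt le_a hp.
have q0 : 0 < q by apply: leq_trans q_gt.
have E : (q ^ q) ^ (2 ^ q) = 2 ^ (r * q * 2 ^ q) by rewrite {1}qr -!expnM mulnA.
have p_gt : 2 ^ (2 ^ (3 * a)) < p := leq_ltn_trans (tower_bound a) hp.
have rq : r < q by rewrite qr ltn_expl.
apply: (@final_bound_lt q (2 ^ (r + r + q)) ((q ^ q) ^ (2 ^ q))) => //.
- rewrite qr -expnS ltn_exp2l // -qr.
  by move: q_gt; clear; lia.
- rewrite E leq_exp2l // !expnD leq_mul2r; apply/orP; right.
  by rewrite -qr leq_mul // ltnW.
- by apply: leq_ltn_trans p_gt; rewrite expn_gt0.
- by move=> n n0; apply: ndiv_exp_leq.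
apply: leq_ltn_trans p_gt; rewrite leq_exp2l // -[1024]/(2 ^ 10) -expnD leq_exp2l //.
by rewrite addnC.
Qed.

(** 256 = 2^8 is the first power of 2 above 242, and 8 + 8 + 256 + 10 = 282 is at most 3 * 100. *)
Lemma final_bound_lt_large p : 10 ^ (10 ^ 100) < p -> final_bound (order_bound p) < p.
Proof. exact: (@final_bound_lt_tower 100 256 8). Qed.

(** * From orbits to Gamma *)

Section Action.
Variable R : comNzRingType.
Local Open Scope ring_scope.
Implicit Types P Q : 3.-tuple R.

Lemma eval_atX P i : eval_at P 'X_i = tnth P i.
Proof. by rewrite /eval_at mmapX mmap1U. Qed.

Lemma eval_atB P f g : eval_at P (f - g) = eval_at P f - eval_at P g.
Proof. exact: (rmorphB (mmap (intr : int -> R) (tnth P))). Qed.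

Lemma eval_atD P f g : eval_at P (f + g) = eval_at P f + eval_at P g.
Proof. exact: (rmorphD (mmap (intr : int -> R) (tnth P))). Qed.

Lemma eval_atM P f g : eval_at P (f * g) = eval_at P f * eval_at P g.
Proof. exact: (rmorphM (mmap (intr : int -> R) (tnth P))). Qed.

Lemma eval_at_comp P f (g : polymap) :
  eval_at P (f \mPo g) = eval_at (polymap_act g P) f.
Proof.
rewrite /eval_at /comp_mpoly {2}/mmap {1}[mmap _ _ f]/mmap.
rewrite (rmorph_sum (mmap (intr : int -> R) (tnth P))); apply: eq_bigr => m _.
rewrite rmorphM /= mmapC; congr (_ * _).
rewrite /mmap1 (rmorph_prod (mmap (intr : int -> R) (tnth P))); apply: eq_bigr => i _.
by rewrite rmorphXn tnth_mktuple.
Qed.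

Lemma polymap_act_comp g f P : polymap_act (polymap_comp g f) P = polymap_act g (polymap_act f P).
Proof. by apply: eq_from_tnth => i; rewrite !tnth_mktuple eval_at_comp. Qed.

Lemma polymap_act_id P : polymap_act polymap_id P = P.
Proof. by apply: eq_from_tnth => i; rewrite !tnth_mktuple eval_atX. Qed.

Definition triple (u : R * R * R) : 3.-tuple R := [tuple u.1.1; u.1.2; u.2].

Lemma tnth_triple u (i : 'I_3) : tnth (triple u) i = nth 0 [:: u.1.1; u.1.2; u.2] i.
Proof. exact: tnth_nth. Qed.

Lemma tripleK P : triple (tnth P (inord 0), tnth P (inord 1), tnth P (inord 2)) = P.
Proof.
apply: eq_from_tnth => i; rewrite tnth_triple.
by case: i => [[|[|[|i]]] hi] //=; congr tnth; apply: val_inj; rewrite /= inordK.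
Qed.

Lemma eval_axis u i : (i < 3)%N -> eval_at (triple u) (axis i) = nth 0 [:: u.1.1; u.1.2; u.2] i.
Proof. by move=> hi; rewrite /axis eval_atX tnth_triple inordK. Qed.

Lemma eval_markoff_poly u : eval_at (triple u) markoff_poly =
  u.1.1 ^+ 2 + u.1.2 ^+ 2 + u.2 ^+ 2 - u.1.1 * u.1.2 * u.2.
Proof.
by rewrite /markoff_poly !expr2 eval_atB !eval_atD !eval_atM !eval_axis.
Qed.

Lemma act_vieta u : polymap_act vieta (triple u) =
  triple (u.1.1, u.1.2, u.1.1 * u.1.2 - u.2).
Proof.
apply: eq_from_tnth => i; rewrite tnth_mktuple tnth_triple.
case: i => [[|[|[|i]]] hi] //; rewrite (tnth_nth 0) /=.
- by rewrite eval_axis.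
- by rewrite eval_axis.
- by rewrite eval_atB eval_atM !eval_axis.
Qed.

Lemma act_perm (s : 'S_3) P : polymap_act (Defs.perm_map s) P = [tuple tnth P (s i) | i < 3].
Proof. by apply: eq_from_tnth => i; rewrite !tnth_mktuple eval_atX. Qed.

Lemma act_swap12 u : polymap_act (Defs.perm_map (tperm (inord 0) (inord 1))) (triple u) =
  triple (u.1.2, u.1.1, u.2).
Proof.
rewrite act_perm; apply: eq_from_tnth => i; rewrite tnth_mktuple !tnth_triple.
have ext (k : nat) (hk : (k < 3)%N) : Ordinal hk = inord k by apply: val_inj; rewrite /= inordK.
case: i => [[|[|[|i]]] hi] //; rewrite ext ?tpermL ?tpermR ?inordK //.
rewrite tpermD ?inordK //; apply/eqP=> /(congr1 val); rewrite /= !inordK //.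
Qed.

Lemma act_swap23 u : polymap_act (Defs.perm_map (tperm (inord 1) (inord 2))) (triple u) =
  triple (u.1.1, u.2, u.1.2).
Proof.
rewrite act_perm; apply: eq_from_tnth => i; rewrite tnth_mktuple !tnth_triple.
have ext (k : nat) (hk : (k < 3)%N) : Ordinal hk = inord k by apply: val_inj; rewrite /= inordK.
case: i => [[|[|[|i]]] hi] //; rewrite ext ?tpermL ?tpermR ?inordK //.
rewrite tpermD ?inordK //; apply/eqP=> /(congr1 val); rewrite /= !inordK //.
Qed.

(** The polynomial itself is invariant, not only its zero set; for an inverse f of g, the hypothesis
    on g is used at f(P). *)
Lemma eval_markoff_Gamma g P : Gamma g -> eval_at (polymap_act g P) markoff_poly = eval_at P markoff_poly.
Proof.
move=> Gg; elim: Gg P => {g} [s||| g f _ IHg _ IHf | g f gf fg _ IH] P.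
- rewrite act_perm -(tripleK P) -(tripleK [tuple _ | i < 3]) !eval_markoff_poly !tnth_mktuple /=.
  rewrite !tripleK.
  have sumE (T : 'I_3 -> R) : T (inord 0) + T (inord 1) + T (inord 2) = \sum_i T i.
    rewrite !big_ord_recl big_ord0 addr0 addrA.
    by congr (T _ + T _ + T _); apply: val_inj; rewrite /= inordK.
  have prodE (T : 'I_3 -> R) : T (inord 0) * T (inord 1) * T (inord 2) = \prod_i T i.
    rewrite !big_ord_recl big_ord0 mulr1 mulrA.
    by congr (T _ * T _ * T _); apply: val_inj; rewrite /= inordK.
  rewrite (sumE (fun i => tnth P (s i) ^+ 2)) (prodE (fun i => tnth P (s i))).
  rewrite (sumE (fun i => tnth P i ^+ 2)) (prodE (fun i => tnth P i)).
  by congr (_ - _); symmetry; exact: reindex_inj perm_inj.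
- by rewrite -(tripleK P) act_vieta !eval_markoff_poly /=; ring.
- by rewrite polymap_act_id.
- by rewrite polymap_act_comp IHg IHf.
- by rewrite -IH -polymap_act_comp gf polymap_act_id.
Qed.

End Action.

Lemma bgs_boundE : bgs_bound = (10 ^ (10 ^ 100))%N.
Proof. by rewrite /bgs_bound. Qed.

(** * Transitivity for large primes *)

Section Transitive.
Variables (p : nat) (p_pr : prime p).
Local Open Scope ring_scope.

Definition move_rel (P Q : 'F_p * 'F_p * 'F_p) :=
  [|| Q == swap12 P, Q == swap23 P | Q == vieta_move P].

Lemma swap12K : involutive (@swap12 'F_p). Proof. by move=> [[x y] z]. Qed.
Lemma swap23K : involutive (@swap23 'F_p). Proof. by move=> [[x y] z]. Qed.
Lemma vieta_moveK : involutive (@vieta_move 'F_p).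
Proof. by move=> [[x y] z]; rewrite /vieta_move /= subKr. Qed.

Lemma move_rel_sym : symmetric move_rel.
Proof.
have inv (h : 'F_p * 'F_p * 'F_p -> 'F_p * 'F_p * 'F_p) P Q : involutive h -> (Q == h P) = (P == h Q).
  by move=> hK; apply/eqP/eqP=> ->; rewrite hK.
move=> P Q; rewrite /move_rel (inv _ P Q swap12K) (inv _ P Q swap23K).
by rewrite (inv _ P Q vieta_moveK).
Qed.

Lemma move_rel_markoff P Q : move_rel P Q -> P \in markoff_points _ -> Q \in markoff_points _.
Proof.
move=> PQ; rewrite !inE /on_markoff => /andP[/eqP eP P0]; apply/andP; split.
  apply/eqP; case/or3P: PQ => /eqP -> /=.
  - by rewrite [P.1.2 * _]mulrC -eP; ring.
  - by rewrite mulrAC -eP; ring.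
  - by move/eqP: eP; rewrite -subr_eq0 => /eqP eP; apply/eqP; rewrite -subr_eq0 -eP; apply/eqP; ring.
have z0 : 0 * 0 - 0 = 0 :> 'F_p by rewrite mulr0 subr0.
apply: contra_neq P0 => Q0; move: PQ; rewrite move_rel_sym /move_rel Q0 /swap12 /swap23 /vieta_move /= z0.
by case/or3P=> /eqP.
Qed.

Lemma move_rel_Gamma P Q : move_rel P Q ->
  exists2 g, Gamma g & polymap_act g (triple P) = triple Q.
Proof.
case/or3P=> /eqP ->.
- exists (Defs.perm_map (tperm (inord 0) (inord 1))); [exact: Gamma_perm | exact: act_swap12].
- exists (Defs.perm_map (tperm (inord 1) (inord 2))); [exact: Gamma_perm | exact: act_swap23].
- by exists vieta; [exact: Gamma_vieta | exact: act_vieta].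
Qed.

Lemma connect_Gamma P Q : connect move_rel P Q ->
  exists2 g, Gamma g & polymap_act g (triple P) = triple Q.
Proof.
case/connectP=> s; elim: s P => [|R s IH] P /=.
  by move=> _ ->; exists polymap_id; [exact: Gamma_id | exact: polymap_act_id].
case/andP=> /move_rel_Gamma[f Gf ef] hs eQ; have [g Gg eg] := IH R hs eQ.
by exists (polymap_comp g f); [exact: Gamma_comp | rewrite polymap_act_comp ef].
Qed.

Definition component P : {set 'F_p * 'F_p * 'F_p} := [set Q | connect move_rel P Q].

Lemma component_stable P : stable (component P).
Proof.
move=> Q; rewrite !inE => PQ.
by split; apply: connect_trans PQ (connect1 _); rewrite /move_rel eqxx ?orbT.
Qed.

Lemma component_sub P : P \in markoff_points _ -> component P \subset markoff_points _.
Proof.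
move=> PM; apply/subsetP=> Q; rewrite inE => /connectP[s].
elim: s P PM => [|R s IH] P PM /=; first by move=> _ ->.
by case/andP=> PR; apply: IH; apply: move_rel_markoff PM.
Qed.

Lemma component_neq0 P : component P != set0.
Proof. by apply/set0Pn; exists P; rewrite inE connect0. Qed.

Lemma markoff_starE (P : 'F_p * 'F_p * 'F_p) : @markoff_star p (triple P) -> P \in markoff_points _.
Proof.
rewrite /markoff_star /markoff /= eval_markoff_poly => -[/eqP e n0].
rewrite inE /on_markoff -subr_eq0 e; apply/eqP=> P0; apply: n0.
by rewrite P0; apply: eq_from_tnth => i; rewrite tnth_mktuple tnth_triple; case: i => [[|[|[|]]]].
Qed.

Lemma transitive_large : (bgs_bound < p)%N -> Gamma_transitive p.
Proof.
rewrite bgs_boundE => /final_bound_lt_large p_large.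
move=> P Q; rewrite -(tripleK P) -(tripleK Q); set P' := (_, _, _); set Q' := (_, _, _).
move=> /markoff_starE PM /markoff_starE QM.
have [R] := stable_meet p_pr p_large (component_stable (P := P')) (component_sub PM) (component_neq0 P')
  (component_stable (P := Q')) (component_sub QM) (component_neq0 Q').
rewrite !inE => /andP[PR QR]; apply/connect_Gamma/(connect_trans PR).
by rewrite (sym_connect_sym move_rel_sym).
Qed.

End Transitive.

(** * Lifting to integral points *)

Section StrongApproximation.
Local Open Scope ring_scope.

Lemma eval_at_reduction p (P : 3.-tuple int) f :
  eval_at (reduction p P) f = (eval_at P f)%:~R.
Proof.
rewrite /eval_at /mmap (rmorph_sum (intr : int -> 'F_p)); apply: eq_bigr => m _.
rewrite rmorphM /= intz; congr (_ * _); rewrite /mmap1 (rmorph_prod (intr : int -> 'F_p)).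
by apply: eq_bigr => i _; rewrite rmorphXn tnth_mktuple.
Qed.

Lemma reduction_act p g (P : 3.-tuple int) :
  polymap_act g (reduction p P) = reduction p (polymap_act g P).
Proof. by apply: eq_from_tnth => i; rewrite !tnth_mktuple eval_at_reduction. Qed.

Lemma reduction_triple p (u : int * int * int) :
  reduction p (triple u) = triple (u.1.1%:~R, u.1.2%:~R, u.2%:~R).
Proof.
by apply: eq_from_tnth => i; rewrite tnth_mktuple !tnth_triple; case: i => [[|[|[|]]]].
Qed.

Lemma markoff_F3 (P : 3.-tuple 'F_3) : markoff P -> P = origin 'F_3.
Proof.
rewrite -(tripleK P); set u := (_, _, _); rewrite /markoff /= eval_markoff_poly => /eqP e.
have : [forall v : 'F_3 * 'F_3 * 'F_3,
   (v.1.1 ^+ 2 + v.1.2 ^+ 2 + v.2 ^+ 2 - v.1.1 * v.1.2 * v.2 == 0) ==> (v == (0, 0, 0))].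
  apply/forallP=> -[[[[|[|[|//]]] ?] [[|[|[|//]]] ?]] [[|[|[|//]]] ?]];
  by apply/implyP.
move/forallP/(_ u); rewrite e => /eqP ->.
by apply: eq_from_tnth => i; rewrite tnth_mktuple tnth_triple; case: i => [[|[|[|]]]].
Qed.

(** Gamma commutes with reduction, so an element taking the reduction of (3, 3, 3) to Q takes (3, 3,
    3) itself to an integral lift of Q. At p = 3 this base point reduces to the origin, but so must
    Q be the origin. *)
Lemma transitive_strong_approximation p : prime p -> Gamma_transitive p -> strong_approximation_at p.
Proof.
move=> p_pr tr Q MQ; rewrite /=.
have red0 : reduction p (origin int) = origin 'F_p.
  by apply: eq_from_tnth => i; rewrite !tnth_mktuple.
have orig0 : @markoff int (origin int).
  rewrite /markoff /= -(tripleK (origin int)) eval_markoff_poly !tnth_mktuple /=.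
  by ring.
have [Q0|Q0] := eqVneq Q (origin 'F_p).
  by exists (origin int); rewrite ?red0.
have [p3|p3] := eqVneq p 3%N.
  by move: p3 Q MQ Q0 {red0 tr p_pr}; move=> -> Q MQ; rewrite (markoff_F3 MQ) eqxx.
pose B : 3.-tuple int := triple (3, 3, 3).
have MB : eval_at B markoff_poly = 0 by rewrite eval_markoff_poly.
have B0 : @markoff_star p (reduction p B).
  split; first by rewrite /markoff /= eval_at_reduction MB.
  rewrite reduction_triple => /(congr1 (fun P => tnth P ord0)).
  rewrite tnth_triple tnth_mktuple /= => /eqP.
  rewrite -[3%:~R]/(3%:R) -(dvdn_pcharf (pchar_Fp p_pr)) dvdn_prime2 //.
  by rewrite (negbTE p3).
have [g Gg eg] := tr _ _ B0 (conj MQ (fun e => negP Q0 (introT eqP e))).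
exists (polymap_act g B); last by rewrite -reduction_act.
by rewrite /markoff /= eval_markoff_Gamma.
Qed.

End StrongApproximation.

Theorem theorem1p2p6 :
  (finite_set E_bgs /\ (forall p : nat, E_bgs p -> (p <= bgs_bound)%N)) /\
  (forall p : nat, prime p -> ~ E_bgs p -> strong_approximation_at p).
Proof.
have bound p : E_bgs p -> (p <= bgs_bound)%N.
  case=> p_pr ntr; rewrite leqNgt; apply/negP=> hp.
  by apply: ntr; apply: transitive_large.
split; last first.
  move=> p p_pr nE; apply: transitive_strong_approximation => //.
  (* [E_bgs] is defined by a negation, so transitivity is recovered classically. *)
  by apply: NNPP => ntr; apply: nE; split.
split=> //; move: bgs_bound bound => n bound.
by apply: sub_finite_set (finite_II n.+1) => p /bound; rewrite /= ltnS.
Qed.
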